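(* (i) For every oriented $\mathrm{el}_2^{RO}$-algebra $(X,a,t)$, the $\mathrm{el}_2$-$\mathbb F_2$-algebra $t^{-1}X$ is a global 2-torsion group law with respect to the coordinate $e=a/t$. (ii) The functor $$t^{-1}:(\text{oriented }\mathrm{el}_2^{RO}\text{-algebras})\to(\text{global 2-torsion group laws}),\quad (X,a,t)\mapsto(t^{-1}X,a/t)$$ has a fully faithful right adjoint. The essential image of the right adjoint is the (full) subcategory of invertibly oriented $\mathrm{el}_2^{RO}$-algebras.
   Context: Write $C=\{\pm1\}$. An elementary abelian 2-group is a finite group isomorphic to $C^n$ for some $n\ge 0$. Representations are finite-dimensional and real. A character of $A$ is a homomorphism $\lambda:A\to C$, identified with the 1-dimensional representation on $\mathbb R$ with $g\cdot x=\lambda(g)x$ and with its class in the real representation ring $RO(A)$; $\sigma$ is the sign representation of $C$ (the identity character). For a finite group $G$ put $I_G=\{k-V: k\in\mathbb Z,\ V \text{ a } G\text{-representation}\}\subset RO(G)$. The category $\mathrm{el}_2^{RO}$ has objects the pairs $(A,m)$ with $A$ an elementary abelian 2-group and $m\in I_A$; morphisms $(B,n)\to(A,m)$ are group homomorphisms $\alpha:B\to A$ with $\alpha^*(m)=n$. It is symmetric monoidal under $(A,m)\times(B,n)=(A\times B,\,p_1^*(m)+p_2^*(n))$ with unit $(1,0)$. An $\mathrm{el}_2^{RO}$-algebra is a lax symmetric monoidal functor $X:(\mathrm{el}_2^{RO})^{\mathrm{op}}\to(\mathbb F_2\text{-vector spaces},\otimes)$; morphisms are monoidal transformations. Write $\alpha^*:X(A,m)\to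 X(B,\alpha^*(m))$ for the restriction maps, and $\mathrm{res}^A_B$ for restriction to a subgroup. Composing the monoidal pairing with restriction along the diagonal of $A$ gives products $X(A,m)\otimes X(A,n)\to X(A,m+n)$, making $X(A,\star)$ a commutative $I_A$-graded $\mathbb F_2$-algebra. An orientable $\mathrm{el}_2^{RO}$-algebra is a pair $(X,a)$ with $a\in X(C,-\sigma)$ such that for every elementary abelian 2-group $A$, every $m\in I_A$ and every nontrivial character $\lambda$ of $A$ with kernel $K$, the sequence $$0\to X(A,m)\xrightarrow{a_\lambda\cdot-}X(A,m-\lambda)\xrightarrow{\mathrm{res}^A_K}X(K,\mathrm{res}^A_K(m)-1)\to 0$$ is exact, where $a_\lambda=\lambda^*(a)$. An inverse Thom class is a class $t\in X(C,1-\sigma)$ with $\mathrm{res}^C_1(t)=1\in X(1,0)$; put $t_\lambda=\lambda^*(t)$ and $t_V=\prod_\lambda t_\lambda^{m_\lambda}$, where $m_\lambda$ is the multiplicity of $\lambda$ in the $A$-representation $V$. An oriented $\mathrm{el}_2^{RO}$-algebra is a triple $(X,a,t)$ with $(X,a)$ orientable and $t$ an inverse Thom class; morphisms preserve $a$ and $t$. It is invertibly oriented if for every $A$, every nontrivial character $\lambda$ of $A$ and all $m\in I_A$, multiplication $t_\lambda\cdot-:X(A,m)\to X(A,m+1-\lambda)$ is an isomorphism. An $\mathrm{el}_2$-$\mathbb F_2$-algebra is a contravariant functor from the category of elementary abelian 2-groups and all group homomorphisms to commutative $\mathbb Z$-graded $\mathbb F_2$-algebras. A global 2-torsion group law is an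 $\mathrm{el}_2$-$\mathbb F_2$-algebra $\mathcal G$ with a coordinate, i.e. a class $e\in\mathcal G(C)_{-1}$ such that for every nontrivial character $\lambda$ of an elementary abelian 2-group $A$ with kernel $K$ the sequence $0\to\mathcal G(A)_{*+1}\xrightarrow{e_\lambda\cdot-}\mathcal G(A)_*\xrightarrow{\mathrm{res}^A_K}\mathcal G(K)_*\to0$ is exact, $e_\lambda=\lambda^*(e)$; morphisms preserve the coordinate. For an oriented $(X,a,t)$, the $\mathrm{el}_2$-$\mathbb F_2$-algebra $t^{-1}X$ is given by: $(t^{-1}X)(A)$ is the integer graded part of the localization of $X(A,\star)$ obtained by inverting $t_\lambda$ for all nontrivial characters $\lambda$ of $A$; degree $k$ elements are fractions $x/t_V$ with $V$ an $A$-representation and $x\in X(A,k+\dim V-V)$. Restriction along any $\alpha:B\to A$ is $\alpha^*(x/t_V)=\alpha^*(x)/t_{\alpha^*(V)}$. *)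

(* Defs.v *)
From HB Require Import structures.
From mathcomp Require Import all_boot all_order all_algebra all_fingroup.
From mathcomp Require Import generic_quotient cyclic abelian mxrepresentation.
From mathcomp Require Import boolp reals.
From mathcomp Require Import ring zify.

Set Implicit Arguments.
Unset Strict Implicit.
Unset Printing Implicit Defensive.

Import GRing.Theory.
Local Open Scope quotient_scope.
Local Open Scope ring_scope.

Record el2 := El2 {
  el2_group :> finGroupType;
  el2_abelem : (2.-abelem [set: el2_group])%g
}.

Notation el2_hom B A :=
  (@morphism (el2_group B) (el2_group A) [set: el2_group B]).

Definition mk_hom (B A : el2) (f : B -> A)
    (fM : {morph f : x y / (x * y)%g >-> (x * y)%g}) : el2_hom B A :=
  @Morphism B A [set: B] f (fun x y _ _ => fM x y).

Lemma homM (B A : el2) (f : el2_hom B A) x y : f (x * y)%g = (f x * f y)%g.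
Proof. by rewrite morphM ?inE. Qed.

Lemma hom1 (B A : el2) (f : el2_hom B A) : f 1%g = 1%g.
Proof. exact: morph1. Qed.

Lemma el2_hom_eq (B A : el2) (f g : el2_hom B A) : f =1 g -> f = g.
Proof.
case: f g => [f fM] [g gM] /= /funext fg; rewrite fg in fM *.
by congr Morphism; apply: Prop_irrelevance.
Qed.

Lemma el2_sqr (gT : finGroupType) :
  (forall x : gT, (x * x = 1)%g) -> (2.-abelem [set: gT])%g.
Proof.
by move=> sq; apply: exponent2_abelem; apply/exponentP => x _; exact: sq.
Qed.

Lemma el2_mulgg (A : el2) (x : A) : (x * x = 1)%g.
Proof.
have /abelemP-/(_ isT)[_ h] := el2_abelem A.
by have := h x (in_setT x).
Qed.

Definition id_hom (A : el2) : el2_hom A A :=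
  @mk_hom A A id (fun x y => erefl).

Lemma comp_homM (D B A : el2) (f : el2_hom B A) (g : el2_hom D B) :
  {morph (fun x => f (g x)) : x y / (x * y)%g >-> (x * y)%g}.
Proof. by move=> x y /=; rewrite !homM. Qed.

Definition comp_hom (D B A : el2) (f : el2_hom B A) (g : el2_hom D B) :
  el2_hom D A := mk_hom (comp_homM f g).

Lemma trivial_abelem : (2.-abelem [set: 'I_1])%g.
Proof. by apply: el2_sqr => x; rewrite [LHS]ord1. Qed.

Definition trivial_el2 : el2 := El2 trivial_abelem.

Lemma to_trivialM (A : el2) :
  {morph (fun _ : A => 1%g : trivial_el2) : x y / (x * y)%g >-> (x * y)%g}.
Proof. by move=> x y; rewrite mulg1. Qed.

Definition to_trivial (A : el2) : el2_hom A trivial_el2 :=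
  mk_hom (@to_trivialM A).

Lemma prod_abelem (A B : el2) : (2.-abelem [set: (A * B)%type])%g.
Proof.
apply: el2_sqr => -[x y].
by transitivity (x * x, y * y)%g; rewrite // !el2_mulgg.
Qed.

Definition prod_el2 (A B : el2) : el2 := El2 (prod_abelem A B).

Definition fst_hom (A B : el2) : el2_hom (prod_el2 A B) A :=
  @mk_hom (prod_el2 A B) A fst (fun x y => erefl).

Definition snd_hom (A B : el2) : el2_hom (prod_el2 A B) B :=
  @mk_hom (prod_el2 A B) B snd (fun x y => erefl).

Lemma pair_homM (D A B : el2) (f : el2_hom D A) (g : el2_hom D B) :
  {morph (fun x => (f x, g x) : prod_el2 A B) :
    x y / (x * y)%g >-> (x * y)%g}.
Proof. by move=> x y; rewrite !homM. Qed.

Definition pair_hom (D A B : el2) (f : el2_hom D A) (g : el2_hom D B) :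
  el2_hom D (prod_el2 A B) := mk_hom (pair_homM f g).

(* C = {1, -1} is modelled by the cyclic group 'Z_2, whose element c stands
   for the sign (-1) ^+ c. *)
Lemma C_abelem : (2.-abelem [set: 'Z_2])%g.
Proof. by apply: el2_sqr => x; apply/eqP; case: x => -[|[|]]. Qed.

Definition C : el2 := El2 C_abelem.

Record chr (A : el2) := Chr {
  chr_fun :> {ffun A -> C};
  chr_morphic : morphic [set: A] chr_fun
}.

HB.instance Definition _ (A : el2) := [isSub for @chr_fun A].
HB.instance Definition _ (A : el2) := [Finite of chr A by <:].

Lemma chrM (A : el2) (l : chr A) :
  {morph l : x y / (x * y)%g >-> (x * y)%g}.
Proof. by move=> x y; apply: (morphicP (chr_morphic l)); rewrite inE. Qed.

Definition chr_hom (A : el2) (l : chr A) : el2_hom A C := mk_hom (chrM l).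

Lemma hom_morphic (A : el2) (f : el2_hom A C) :
  morphic [set: A] [ffun x => f x].
Proof. by apply/morphicP => x y _ _; rewrite !ffunE homM. Qed.

Definition hom_chr (A : el2) (f : el2_hom A C) : chr A := Chr (hom_morphic f).

Definition chr_pull (B A : el2) (f : el2_hom B A) (l : chr A) : chr B :=
  hom_chr (comp_hom (chr_hom l) f).

Lemma chr_pullE (B A : el2) (f : el2_hom B A) (l : chr A) x :
  chr_pull f l x = l (f x).
Proof. by rewrite ffunE. Qed.

Lemma chr_eq (A : el2) (l l' : chr A) : l =1 l' -> l = l'.
Proof. by move=> ll'; apply/val_inj/ffunP. Qed.

Definition sigma : chr C := hom_chr (id_hom C).

Definition nontrivial (A : el2) (l : chr A) : Prop := exists x, l x != 1%g.

Lemma ker_abelem (A : el2) (l : chr A) :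
  (2.-abelem [set: subg_of ('ker (chr_hom l))])%g.
Proof.
apply: el2_sqr => x; apply/val_inj.
by rewrite /= el2_mulgg.
Qed.

Definition ker_chr (A : el2) (l : chr A) : el2 := El2 (ker_abelem l).

Definition ker_incl (A : el2) (l : chr A) : el2_hom (ker_chr l) A :=
  @mk_hom (ker_chr l) A sgval (fun x y => erefl).

Lemma ker_inclP (A : el2) (l : chr A) (x : ker_chr l) :
  l (ker_incl l x) = 1%g.
Proof. by have /morphpreP[_] := subgP x; rewrite inE => /eqP. Qed.

Section RepresentationRing.
Variable R : realType.

(* RO(A) is realised, as in Serre, Linear Representations of Finite Groups,
   12.1, as the ring of virtual characters: the class of a representation V in
   RO(A) is the function g |-> trace of g on V. *)
Definition rep_class (A : el2) (n : nat) (V : mx_representation R [set: A] n) :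
  {ffun A -> R} := [ffun g => \tr (V g)].

Definition in_I (A : el2) (m : {ffun A -> R}) : Prop :=
  exists (k : int) (n : nat) (V : mx_representation R [set: A] n),
    m = k%:~R - rep_class V.

Definition I_pred (A : el2) : pred {ffun A -> R} := fun m => `[< in_I m >].

Lemma in_I_int (A : el2) (k : int) : in_I (k%:~R : {ffun A -> R}).
Proof.
have V0 : mx_repr [set: A] (fun _ : A => 1%:M : 'M[R]_0).
  by split=> // x y _ _; rewrite mulmx1.
exists k, 0%N, (MxRepresentation V0); apply/ffunP => g.
by rewrite !ffunE mxtrace1 subr0.
Qed.

Lemma in_I_add (A : el2) (m n : {ffun A -> R}) :
  in_I m -> in_I n -> in_I (m + n).
Proof.
move=> [k [d [V ->]]] [l [e [W ->]]].
have VW : mx_repr [set: A] (fun g => block_mx (V g) 0 0 (W g)).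
  split=> [|x y Ax Ay]; first by rewrite !repr_mx1 -scalar_mx_block.
  by rewrite mulmx_block !(mulmx0, mul0mx, addr0, add0r, repr_mxM).
exists (k + l), (d + e)%N, (MxRepresentation VW); apply/ffunP => g.
by rewrite intrD !ffunE /= mxtrace_block opprD addrACA.
Qed.

Lemma I_pred_closed (A : el2) : Algebra.addumagma_closed (@I_pred A).
Proof.
split=> [|m n /asboolP mI /asboolP nI]; apply/asboolP; last exact: in_I_add.
exact: (in_I_int A 0).
Qed.

Record I_ (A : el2) := MkI {
  I_val :> {ffun A -> R};
  I_valP : I_val \in @I_pred A
}.

HB.instance Definition _ (A : el2) := [isSub for @I_val A].
HB.instance Definition _ (A : el2) := [Choice of I_ A by <:].
HB.instance Definition _ (A : el2) :=
  GRing.SubChoice_isSubNmodule.Build _ _ (I_ A) (I_pred_closed A).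

Lemma I_eq (A : el2) (m n : I_ A) : m =1 n -> m = n.
Proof. by move=> mn; apply/val_inj/ffunP. Qed.

Lemma I_addE (A : el2) (m n : I_ A) x : (m + n) x = m x + n x.
Proof. by rewrite [LHS]ffunE. Qed.

Lemma I_zeroE (A : el2) x : (0 : I_ A) x = 0.
Proof. by rewrite [LHS]ffunE. Qed.

Lemma int_deg_subproof (A : el2) (k : int) :
  (k%:~R : {ffun A -> R}) \in @I_pred A.
Proof. by apply/asboolP; exact: in_I_int. Qed.

Definition int_deg (A : el2) (k : int) : I_ A := MkI (int_deg_subproof A k).

Lemma int_degE (A : el2) (k : int) x : int_deg A k x = k%:~R.
Proof.
by rewrite /= ffunMzE ffunE.
Qed.

Definition chr_rep (A : el2) (l : chr A) (g : A) : 'M[R]_1 :=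
  ((-1) ^+ (l g))%:M.

Lemma chr_rep_repr (A : el2) (l : chr A) : mx_repr [set: A] (chr_rep l).
Proof.
rewrite /chr_rep; split=> [|x y _ _].
  by have -> : l 1%g = 1%g := hom1 (chr_hom l).
rewrite chrM -scalar_mxM -exprD; congr (_%:M).
by case: (l x) => -[|[|]] // ?; case: (l y) => -[|[|]] // ?;
  rewrite ?expr0 ?expr1 ?expr2 ?mulN1r ?opprK.
Qed.

Definition chr_class (A : el2) (l : chr A) : {ffun A -> R} :=
  rep_class (MxRepresentation (chr_rep_repr l)).

Lemma neg_chr_subproof (A : el2) (l : chr A) : - chr_class l \in @I_pred A.
Proof.
apply/asboolP; exists 0, 1%N, (MxRepresentation (chr_rep_repr l)).
by rewrite sub0r.
Qed.

Definition neg_chr (A : el2) (l : chr A) : I_ A := MkI (neg_chr_subproof l).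

Lemma neg_chrE (A : el2) (l : chr A) x : neg_chr l x = - (-1) ^+ (l x).
Proof. by rewrite /= !ffunE /= /chr_rep mxtrace_scalar. Qed.

Lemma pull_subproof (B A : el2) (f : el2_hom B A) (m : I_ A) :
  [ffun x => m (f x)] \in @I_pred B.
Proof.
have [k [n [V mE]]] := asboolP _ (I_valP m).
have fV : mx_repr [set: B] (fun x => V (f x)).
  by split=> [|x y _ _]; rewrite ?hom1 ?homM ?repr_mx1 ?repr_mxM ?inE.
apply/asboolP; exists k, n, (MxRepresentation fV); apply/ffunP => x.
rewrite ffunE mE [LHS]ffunE [RHS]ffunE !ffunMzE [X in X *~ _]ffunE.
by rewrite [X in _ = X *~ _ + _]ffunE !ffunE.
Qed.

Definition pull (B A : el2) (f : el2_hom B A) (m : I_ A) : I_ B :=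
  MkI (pull_subproof f m).

Lemma pullE (B A : el2) (f : el2_hom B A) (m : I_ A) x :
  pull f m x = m (f x).
Proof. by rewrite ffunE. Qed.

Lemma pull_int (B A : el2) (f : el2_hom B A) k :
  pull f (int_deg A k) = int_deg B k.
Proof. by apply: I_eq => x; rewrite pullE !int_degE. Qed.

Lemma pull_chr (B A : el2) (f : el2_hom B A) (l : chr A) :
  pull f (neg_chr l) = neg_chr (chr_pull f l).
Proof. by apply: I_eq => x; rewrite pullE !neg_chrE chr_pullE. Qed.

Lemma pullD (B A : el2) (f : el2_hom B A) (m n : I_ A) :
  pull f (m + n) = pull f m + pull f n.
Proof. by apply: I_eq => x; rewrite !(pullE, I_addE). Qed.

Lemma pull0 (B A : el2) (f : el2_hom B A) : pull f 0 = 0.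
Proof. by apply: I_eq => x; rewrite !(pullE, I_zeroE). Qed.

Lemma pull_id (A : el2) (m : I_ A) : pull (id_hom A) m = m.
Proof. by apply: I_eq => x; rewrite pullE. Qed.

Lemma pull_comp (D B A : el2) (f : el2_hom B A) (g : el2_hom D B) m :
  pull (comp_hom f g) m = pull g (pull f m).
Proof. by apply: I_eq => x; rewrite !pullE. Qed.

Record el2RO := RO { ro_group :> el2; ro_deg : I_ ro_group }.

Record RO_hom (P Q : el2RO) := MkROHom {
  ro_fun :> el2_hom P Q;
  ro_funP : pull ro_fun (ro_deg Q) = ro_deg P
}.

Lemma RO_hom_eq (P Q : el2RO) (f g : RO_hom P Q) : f =1 g -> f = g.
Proof.
case: f g => [f fP] [g gP] /= /el2_hom_eq fg; rewrite fg in fP *.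
by congr MkROHom; apply: Prop_irrelevance.
Qed.

Definition RO_id (P : el2RO) : RO_hom P P := MkROHom (pull_id (ro_deg P)).

Lemma RO_comp_subproof (P Q S : el2RO) (f : RO_hom Q S) (g : RO_hom P Q) :
  pull (comp_hom f g) (ro_deg S) = ro_deg P.
Proof. by rewrite pull_comp !ro_funP. Qed.

Definition RO_comp (P Q S : el2RO) (f : RO_hom Q S) (g : RO_hom P Q) :
  RO_hom P S := MkROHom (RO_comp_subproof f g).

Definition RO_unit : el2RO := @RO trivial_el2 0.

Definition RO_prod (P Q : el2RO) : el2RO :=
  @RO (prod_el2 P Q)
    (pull (fst_hom P Q) (ro_deg P) + pull (snd_hom P Q) (ro_deg Q)).

Definition prod_hom (A A' B B' : el2) (f : el2_hom A A') (g : el2_hom B B') :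
  el2_hom (prod_el2 A B) (prod_el2 A' B') :=
  pair_hom (comp_hom f (fst_hom A B)) (comp_hom g (snd_hom A B)).

Lemma RO_prod_hom_subproof (P P' Q Q' : el2RO) (f : RO_hom P P')
    (g : RO_hom Q Q') :
  pull (prod_hom f g) (ro_deg (RO_prod P' Q')) = ro_deg (RO_prod P Q).
Proof.
apply: I_eq => x; rewrite pullE !I_addE !pullE.
by rewrite -(ro_funP f) -(ro_funP g) !pullE.
Qed.

Definition RO_prod_hom (P P' Q Q' : el2RO) (f : RO_hom P P')
    (g : RO_hom Q Q') : RO_hom (RO_prod P Q) (RO_prod P' Q') :=
  @MkROHom (RO_prod P Q) (RO_prod P' Q') _ (RO_prod_hom_subproof f g).

Definition assoc_hom (A B D : el2) :
  el2_hom (prod_el2 (prod_el2 A B) D) (prod_el2 A (prod_el2 B D)) :=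
  pair_hom (comp_hom (fst_hom A B) (fst_hom (prod_el2 A B) D))
    (prod_hom (snd_hom A B) (id_hom D)).

Lemma RO_assoc_subproof (P Q S : el2RO) :
  pull (assoc_hom P Q S) (ro_deg (RO_prod P (RO_prod Q S))) =
  ro_deg (RO_prod (RO_prod P Q) S).
Proof. by apply: I_eq => x; rewrite !(pullE, I_addE) addrA. Qed.

Definition RO_assoc (P Q S : el2RO) :
  RO_hom (RO_prod (RO_prod P Q) S) (RO_prod P (RO_prod Q S)) :=
  @MkROHom (RO_prod (RO_prod P Q) S) (RO_prod P (RO_prod Q S)) _
    (RO_assoc_subproof P Q S).

Lemma RO_lunit_subproof (P : el2RO) :
  pull (snd_hom RO_unit P) (ro_deg P) = ro_deg (RO_prod RO_unit P).
Proof. by apply: I_eq => x; rewrite !(pullE, I_addE) I_zeroE add0r. Qed.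

Definition RO_lunit (P : el2RO) : RO_hom (RO_prod RO_unit P) P :=
  @MkROHom (RO_prod RO_unit P) P _ (RO_lunit_subproof P).

Lemma RO_runit_subproof (P : el2RO) :
  pull (fst_hom P RO_unit) (ro_deg P) = ro_deg (RO_prod P RO_unit).
Proof. by apply: I_eq => x; rewrite !(pullE, I_addE) I_zeroE addr0. Qed.

Definition RO_runit (P : el2RO) : RO_hom (RO_prod P RO_unit) P :=
  @MkROHom (RO_prod P RO_unit) P _ (RO_runit_subproof P).

Lemma RO_swap_subproof (P Q : el2RO) :
  pull (pair_hom (snd_hom P Q) (fst_hom P Q)) (ro_deg (RO_prod Q P)) =
  ro_deg (RO_prod P Q).
Proof. by apply: I_eq => x; rewrite !(pullE, I_addE) addrC. Qed.

Definition RO_swap (P Q : el2RO) : RO_hom (RO_prod P Q) (RO_prod Q P) :=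
  @MkROHom (RO_prod P Q) (RO_prod Q P) _ (RO_swap_subproof P Q).

(* A lax symmetric monoidal functor from the opposite of el_2^RO to F_2-vector
   spaces; the structure map X(P) (x) X(Q) -> X(P x Q) is given as the
   corresponding bilinear map, and F_2 -> X(1, 0) as the image of 1. *)
Record el2RO_alg := MkEl2ROAlg {
  alg_obj :> el2RO -> lmodType 'F_2;
  alg_map : forall P Q : el2RO, RO_hom P Q -> {linear alg_obj Q -> alg_obj P};
  alg_map_id : forall (P : el2RO) (x : alg_obj P), alg_map (RO_id P) x = x;
  alg_map_comp : forall (P Q S : el2RO) (f : RO_hom Q S) (g : RO_hom P Q)
    (x : alg_obj S), alg_map (RO_comp f g) x = alg_map g (alg_map f x);
  alg_pair : forall P Q : el2RO,
    alg_obj P -> alg_obj Q -> alg_obj (RO_prod P Q);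
  alg_one : alg_obj RO_unit;
  alg_pair_linearl : forall (P Q : el2RO) (y : alg_obj Q),
    linear (fun x : alg_obj P => alg_pair x y);
  alg_pair_linearr : forall (P Q : el2RO) (x : alg_obj P),
    linear (fun y : alg_obj Q => alg_pair x y);
  alg_pair_natural : forall (P P' Q Q' : el2RO) (f : RO_hom P P')
    (g : RO_hom Q Q') (x : alg_obj P') (y : alg_obj Q'),
    alg_map (RO_prod_hom f g) (alg_pair x y) =
    alg_pair (alg_map f x) (alg_map g y);
  alg_pair_assoc : forall (P Q S : el2RO) (x : alg_obj P) (y : alg_obj Q)
    (z : alg_obj S),
    alg_map (RO_assoc P Q S) (alg_pair x (alg_pair y z)) =
    alg_pair (alg_pair x y) z;
  alg_pair_lunit : forall (P : el2RO) (x : alg_obj P),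
    alg_map (RO_lunit P) x = alg_pair alg_one x;
  alg_pair_runit : forall (P : el2RO) (x : alg_obj P),
    alg_map (RO_runit P) x = alg_pair x alg_one;
  alg_pair_sym : forall (P Q : el2RO) (x : alg_obj P) (y : alg_obj Q),
    alg_map (RO_swap P Q) (alg_pair y x) = alg_pair x y
}.

Record alg_hom (X Y : el2RO_alg) := MkAlgHom {
  ah_fun :> forall P : el2RO, {linear X P -> Y P};
  ah_natural : forall (P Q : el2RO) (f : RO_hom P Q) (x : X Q),
    ah_fun P (alg_map X f x) = alg_map Y f (ah_fun Q x);
  ah_pair : forall (P Q : el2RO) (x : X P) (y : X Q),
    ah_fun (RO_prod P Q) (alg_pair x y) =
    alg_pair (ah_fun P x) (ah_fun Q y);
  ah_one : ah_fun RO_unit (alg_one X) = alg_one Y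
}.

(* res and mul take an equation between degrees as an argument, so that
   elements of X(A, m) and X(A, m') with m = m' provably need no transport. *)
Section Algebra.
Variable X : el2RO_alg.

Definition res (B A : el2) (f : el2_hom B A) (m : I_ A) (n : I_ B)
    (e : pull f m = n) : {linear X (RO m) -> X (RO n)} :=
  @alg_map X (RO n) (RO m) (@MkROHom (RO n) (RO m) f e).

Lemma diag_subproof (A : el2) (m n k : I_ A) (e : m + n = k) :
  pull (pair_hom (id_hom A) (id_hom A)) (ro_deg (RO_prod (RO m) (RO n))) =
  ro_deg (RO k).
Proof. by rewrite /= -e; apply: I_eq => x; rewrite !(pullE, I_addE). Qed.

Definition RO_diag (A : el2) (m n k : I_ A) (e : m + n = k) :
  RO_hom (RO k) (RO_prod (RO m) (RO n)) :=
  @MkROHom (RO k) (RO_prod (RO m) (RO n)) _ (diag_subproof e).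

Definition mul (A : el2) (m n k : I_ A) (e : m + n = k)
    (x : X (RO m)) (y : X (RO n)) : X (RO k) :=
  alg_map X (RO_diag e) (alg_pair x y).

Definition one (A : el2) : X (@RO A 0) :=
  res (pull0 (to_trivial A)) (alg_one X).

Lemma alg_map_eq (P Q : el2RO) (f g : RO_hom P Q) x :
  f =1 g -> alg_map X f x = alg_map X g x.
Proof. by move=> /RO_hom_eq ->. Qed.

Lemma res_id (A : el2) (m : I_ A) (e : pull (id_hom A) m = m) x :
  res e x = x.
Proof. by rewrite -[RHS]alg_map_id; apply: alg_map_eq. Qed.

Lemma res_comp (D B A : el2) (f : el2_hom B A) (g : el2_hom D B)
    (h : el2_hom D A) m n k (e1 : pull f m = n) (e2 : pull g n = k)
    (e3 : pull h m = k) x :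
  h =1 f \o g -> res e2 (res e1 x) = res e3 x.
Proof.
by move=> hE; rewrite -alg_map_comp; apply: alg_map_eq => y; rewrite hE.
Qed.

Lemma mul_linearl A m n k (e : m + n = k :> I_ A) y :
  linear (fun x => mul e x y).
Proof. by move=> a x x'; rewrite /mul alg_pair_linearl linearP. Qed.

Lemma mulDl A m n k (e : m + n = k :> I_ A) x x' y :
  mul e (x + x') y = mul e x y + mul e x' y.
Proof. by have := mul_linearl e y 1 x x'; rewrite !scale1r. Qed.

Lemma mulZl A m n k (e : m + n = k :> I_ A) c x y :
  mul e (c *: x) y = c *: mul e x y.
Proof.
have mul0 : mul e 0 y = 0.
  by apply: (addrI (mul e 0 y)); rewrite -mulDl !addr0.
by have := mul_linearl e y c x 0; rewrite /= mul0 !addr0.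
Qed.

Lemma mul_linearr A m n k (e : m + n = k :> I_ A) x : linear (mul e x).
Proof. by move=> a y y'; rewrite /mul alg_pair_linearr linearP. Qed.

HB.instance Definition _ A m n k (e : m + n = k :> I_ A) x :=
  GRing.isLinear.Build _ _ _ _ (mul e x) (mul_linearr e x).

Lemma mulC A m n k (e : m + n = k :> I_ A) (e' : n + m = k) x y :
  mul e x y = mul e' y x.
Proof. by rewrite /mul -alg_pair_sym -alg_map_comp; apply: alg_map_eq. Qed.

Lemma mulA A m n p mn np k (e1 : m + np = k :> I_ A) (e2 : n + p = np)
    (e3 : mn + p = k) (e4 : m + n = mn) x y z :
  mul e1 x (mul e2 y z) = mul e3 (mul e4 x y) z.
Proof.
rewrite /mul -[in LHS](alg_map_id x) -[in RHS](alg_map_id z).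
rewrite -!alg_pair_natural -alg_pair_assoc -!alg_map_comp.
exact: alg_map_eq.
Qed.

Lemma mul1x A m (e : 0 + m = m :> I_ A) x : mul e (one A) x = x.
Proof.
rewrite /mul /one /res -[in LHS](alg_map_id x) -alg_pair_natural.
rewrite -alg_pair_lunit -!alg_map_comp -[RHS]alg_map_id.
exact: alg_map_eq.
Qed.

Lemma res_mul B A (f : el2_hom B A) m n k m' n' k' (e : m + n = k)
    (e' : m' + n' = k') (ek : pull f k = k') (em : pull f m = m')
    (en : pull f n = n') x y :
  res ek (mul e x y) = mul e' (res em x) (res en y).
Proof.
rewrite /res /mul -alg_pair_natural -!alg_map_comp.
exact: alg_map_eq.
Qed.

Lemma res_one B A (f : el2_hom B A) (e : pull f 0 = 0) :
  res e (one A) = one B.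
Proof. by rewrite /one; apply: res_comp => x. Qed.

End Algebra.

Definition short_exact (U V W : lmodType 'F_2) (f : U -> V) (g : V -> W) :
  Prop :=
  [/\ injective f, (forall y, g y = 0 <-> exists x, f x = y)
    & (forall z, exists y, g y = z)].

Lemma pull_sigma (A : el2) (l : chr A) :
  pull (chr_hom l) (neg_chr sigma) = neg_chr l.
Proof. by apply: I_eq => x; rewrite pullE !neg_chrE ffunE. Qed.

Lemma pull_ker (A : el2) (m : I_ A) (l : chr A) :
  pull (ker_incl l) (m + neg_chr l) =
  pull (ker_incl l) m + int_deg (ker_chr l) (- 1).
Proof.
apply: I_eq => x; rewrite !(pullE, I_addE) int_degE neg_chrE ker_inclP.
by rewrite expr0 mulrN1z.
Qed.

Definition a_chr (X : el2RO_alg) (a : X (RO (neg_chr sigma))) (A : el2)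
  (l : chr A) : X (RO (neg_chr l)) := res X (pull_sigma l) a.

Definition is_orientable (X : el2RO_alg) (a : X (RO (neg_chr sigma))) : Prop :=
  forall (A : el2) (m : I_ A) (l : chr A), nontrivial l ->
    short_exact (mul (addrC (neg_chr l) m) (a_chr a l))
                (res X (pull_ker m l)).

Definition thom_deg (A : el2) (l : chr A) : I_ A := int_deg A 1 + neg_chr l.

Lemma pull_thom (B A : el2) (f : el2_hom B A) (l : chr A) :
  pull f (thom_deg l) = thom_deg (chr_pull f l).
Proof. by rewrite pullD pull_int pull_chr. Qed.

Lemma pull_thom_sigma (A : el2) (l : chr A) :
  pull (chr_hom l) (thom_deg sigma) = thom_deg l.
Proof. by rewrite pullD pull_int pull_sigma. Qed.

Lemma from_trivialM (A : el2) :
  {morph (fun _ : trivial_el2 => 1%g : A) : x y / (x * y)%g >-> (x * y)%g}.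
Proof. by move=> x y; rewrite mulg1. Qed.

Definition from_trivial (A : el2) : el2_hom trivial_el2 A :=
  mk_hom (@from_trivialM A).

Lemma pull_thom_trivial :
  pull (from_trivial C) (thom_deg sigma) = ro_deg RO_unit.
Proof.
apply: I_eq => x; rewrite pullE I_addE int_degE neg_chrE I_zeroE ffunE.
by rewrite expr0 subrr.
Qed.

Definition is_inverse_thom (X : el2RO_alg) (t : X (RO (thom_deg sigma))) :
  Prop := res X pull_thom_trivial t = alg_one X.

Definition t_chr (X : el2RO_alg) (t : X (RO (thom_deg sigma))) (A : el2)
  (l : chr A) : X (RO (thom_deg l)) := res X (pull_thom_sigma l) t.

Record oriented := Oriented {
  or_alg :> el2RO_alg;
  or_a : or_alg (RO (neg_chr sigma));
  or_t : or_alg (RO (thom_deg sigma));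
  or_orientable : is_orientable or_a;
  or_thom : is_inverse_thom or_t
}.

Definition invertibly_oriented (X : oriented) : Prop :=
  forall (A : el2) (l : chr A) (m : I_ A), nontrivial l ->
    bijective (mul (addrC (thom_deg l) m) (t_chr (or_t X) l)).

Record oriented_hom (X Y : oriented) := MkOrientedHom {
  oh_fun :> alg_hom X Y;
  oh_a : oh_fun _ (or_a X) = or_a Y;
  oh_t : oh_fun _ (or_t X) = or_t Y
}.

Record gralg := MkGrAlg {
  gr_obj :> int -> lmodType 'F_2;
  gr_mul : forall i j k : int, i + j = k -> gr_obj i -> gr_obj j -> gr_obj k;
  gr_one : gr_obj 0;
  gr_mul_linearl : forall (i j k : int) (e : i + j = k) (y : gr_obj j),
    linear (fun x => gr_mul e x y);
  gr_mul_linearr : forall (i j k : int) (e : i + j = k) (x : gr_obj i),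
    linear (gr_mul e x);
  gr_mulA : forall (i j l ij jl k : int) (e1 : i + jl = k) (e2 : j + l = jl)
    (e3 : ij + l = k) (e4 : i + j = ij) x y z,
    gr_mul e1 x (gr_mul e2 y z) = gr_mul e3 (gr_mul e4 x y) z;
  gr_mulC : forall (i j k : int) (e : i + j = k) (e' : j + i = k) x y,
    gr_mul e x y = gr_mul e' y x;
  gr_mul1x : forall (i : int) (e : 0 + i = i) x, gr_mul e gr_one x = x
}.

Record gr_hom (G H : gralg) := MkGrHom {
  gh_fun :> forall k : int, {linear G k -> H k};
  gh_mul : forall (i j k : int) (e : i + j = k) x y,
    gh_fun k (gr_mul e x y) = gr_mul e (gh_fun i x) (gh_fun j y);
  gh_one : gh_fun 0 (gr_one G) = gr_one H
}.

Record el2_alg := MkEl2Alg {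
  ea_obj :> el2 -> gralg;
  ea_map : forall B A : el2, el2_hom B A -> gr_hom (ea_obj A) (ea_obj B);
  ea_map_id : forall (A : el2) (k : int) x, ea_map (id_hom A) k x = x;
  ea_map_comp : forall (D B A : el2) (f : el2_hom B A) (g : el2_hom D B)
    (k : int) x, ea_map (comp_hom f g) k x = ea_map g k (ea_map f k x)
}.

Definition e_chr (G : el2_alg) (e : G C (- 1)) (A : el2) (l : chr A) :
  G A (- 1) := ea_map G (chr_hom l) (- 1) e.

Definition is_coordinate (G : el2_alg) (e : G C (- 1)) : Prop :=
  forall (A : el2) (l : chr A) (k : int), nontrivial l ->
    short_exact (gr_mul (addKr 1 k) (e_chr e l)) (ea_map G (ker_incl l) k).

Record group_law := GroupLaw {
  gl_alg :> el2_alg;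
  gl_e : gl_alg C (- 1);
  gl_coordinate : is_coordinate gl_e
}.

Record group_law_hom (G H : group_law) := MkGroupLawHom {
  glh_fun :> forall A : el2, gr_hom (G A) (H A);
  glh_natural : forall (B A : el2) (f : el2_hom B A) (k : int) x,
    glh_fun B k (ea_map G f k x) = ea_map H f k (glh_fun A k x);
  glh_e : glh_fun C (- 1) (gl_e G) = gl_e H
}.

Section Localization.
Variables (X : el2RO_alg) (t : X (RO (thom_deg sigma))).

Definition hel (A : el2) := {m : I_ A & X (RO m)}.

Definition hin (A : el2) (m : I_ A) (x : X (RO m)) : hel A := existT _ m x.

Definition hmul (A : el2) (x y : hel A) : hel A :=
  hin (mul (erefl (tag x + tag y)) (tagged x) (tagged y)).

Definition hone (A : el2) : hel A := hin (one X A).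

Lemma hin_mul (A : el2) (m n k : I_ A) (e : m + n = k) (x : X (RO m))
  (y : X (RO n)) : hin (mul e x y) = hmul (hin x) (hin y).
Proof. by case: _ / e. Qed.

Lemma hin_inj (A : el2) (m : I_ A) : injective (@hin A m).
Proof. by move=> x y /eqP; rewrite eq_Tagged => /eqP. Qed.

Lemma hmulA (A : el2) : associative (@hmul A).
Proof.
case=> [m x] [n y] [p z]; rewrite -!/(hin _).
rewrite -(hin_mul (erefl (n + p))) -(hin_mul (erefl (m + n))).
rewrite -(hin_mul (addrA m n p)) -(hin_mul (erefl (m + n + p))).
by congr hin; apply: mulA.
Qed.

Lemma hmulC (A : el2) : commutative (@hmul A).
Proof.
case=> [m x] [n y]; rewrite -!/(hin _).
rewrite -(hin_mul (addrC m n)) -(hin_mul (erefl (n + m))).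
by congr hin; apply: mulC.
Qed.

Lemma hmul1x (A : el2) : left_id (@hone A) (@hmul A).
Proof.
by case=> [m x]; rewrite -!/(hin _) -(hin_mul (add0r m)) mul1x.
Qed.

HB.instance Definition _ (A : el2) :=
  Monoid.isComLaw.Build (hel A) (@hone A) (@hmul A)
    (@hmulA A) (@hmulC A) (@hmul1x A).

Definition hexp (A : el2) (x : hel A) (n : nat) : hel A :=
  iter n (hmul x) (hone A).

Lemma hexpD (A : el2) (x : hel A) (n p : nat) :
  hexp x (n + p)%N = hmul (hexp x n) (hexp x p).
Proof.
elim: n => [|n IH]; first by rewrite hmul1x.
by rewrite addSn /hexp !iterS -!/(hexp _ _) IH hmulA.
Qed.

(* A function v from characters to natural numbers stands for the
   representation V that contains each character lambda with multiplicity
   v lambda: real representations of A are, up to isomorphism, of this form,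
   and t_V depends on nothing else.  Addition is the direct sum, and rep_deg v
   is dim V - V, the degree of t_V.  Denominators may involve the trivial
   character, whose t is the unit for an inverse Thom class. *)
Definition rep (A : el2) := {ffun chr A -> nat}.

Definition rep_deg (A : el2) (v : rep A) : I_ A := \sum_l thom_deg l *+ v l.

Lemma rep_degD (A : el2) (v w : rep A) :
  rep_deg (v + w) = rep_deg v + rep_deg w.
Proof.
by rewrite -big_split; apply: eq_bigr => l _; rewrite ffunE mulrnDr.
Qed.

Lemma rep_deg0 (A : el2) : rep_deg (0 : rep A) = 0.
Proof. by apply: big1 => l _; rewrite ffunE. Qed.

Definition ht (A : el2) (v : rep A) : hel A :=
  \big[@hmul A/hone A]_l hexp (hin (t_chr t l)) (v l).

Lemma tag_ht (A : el2) (v : rep A) : tag (ht v) = rep_deg v.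
Proof.
rewrite (big_morph (fun x : hel A => tag x) (id1 := 0) (op1 := +%R)) //.
by apply: eq_bigr => l _; elim: (v l) => [|n IH] //=; rewrite mulrS IH.
Qed.

Definition t_rep (A : el2) (v : rep A) : X (RO (rep_deg v)) :=
  ecast m (X (RO m)) (tag_ht v) (tagged (ht v)).

Lemma hin_t_rep (A : el2) (v : rep A) : hin (t_rep v) = ht v.
Proof.
rewrite /t_rep; case: _ / (tag_ht v) => /=.
by case: (ht v).
Qed.

Lemma htD (A : el2) (v w : rep A) : ht (v + w) = hmul (ht v) (ht w).
Proof.
by rewrite -big_split; apply: eq_bigr => l _; rewrite ffunE; exact: hexpD.
Qed.

Lemma ht0 (A : el2) : ht (0 : rep A) = hone A.
Proof. by apply: big1 => l _; rewrite ffunE. Qed.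

Definition tmul (A : el2) (v : rep A) (m n : I_ A) (e : rep_deg v + m = n) :
  X (RO m) -> X (RO n) := mul e (t_rep v).

HB.instance Definition _ A v m n (e : rep_deg v + m = n :> I_ A) :=
  GRing.isLinear.Build _ _ _ _ (tmul e) (mul_linearr e (t_rep v)).

Lemma hin_tmul A v m n (e : rep_deg v + m = n :> I_ A) x :
  hin (tmul e x) = hmul (ht v) (hin x).
Proof. by rewrite hin_mul hin_t_rep. Qed.

Lemma tmul_eq A v v' m n (e : rep_deg v + m = n :> I_ A)
  (e' : rep_deg v' + m = n) x : v = v' -> tmul e x = tmul e' x.
Proof. by move=> vv'; apply: hin_inj; rewrite !hin_tmul vv'. Qed.

Lemma tmul_tmul A v w u m n k (e1 : rep_deg v + n = k :> I_ A)
    (e2 : rep_deg w + m = n) (e3 : rep_deg u + m = k) x :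
  u = v + w -> tmul e1 (tmul e2 x) = tmul e3 x.
Proof. by move=> uE; apply: hin_inj; rewrite !hin_tmul uE htD hmulA. Qed.

Lemma tmul0 A m (e : rep_deg 0 + m = m :> I_ A) x : tmul e x = x.
Proof. by apply: hin_inj; rewrite hin_tmul ht0 hmul1x. Qed.

Definition frac (A : el2) (k : int) :=
  {v : rep A & X (RO (int_deg A k + rep_deg v))}.

Definition mk_frac (A : el2) (k : int) (v : rep A)
  (x : X (RO (int_deg A k + rep_deg v))) : frac A k := existT _ v x.

(* x / t_V = y / t_W when t_U t_W x = t_U t_V y for some U *)
Definition frac_eq (A : el2) (k : int) (f g : frac A k) : bool :=
  `[< exists u : rep A,
        hmul (ht u) (hmul (ht (tag g)) (hin (tagged f))) =
        hmul (ht u) (hmul (ht (tag f)) (hin (tagged g))) >].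

Lemma frac_eq_refl (A : el2) (k : int) : reflexive (@frac_eq A k).
Proof. by move=> f; apply/asboolP; exists 0. Qed.

Lemma frac_eq_sym (A : el2) (k : int) : symmetric (@frac_eq A k).
Proof. by move=> f g; apply: asbool_equiv_eq; split=> -[u uE]; exists u. Qed.

Lemma frac_eq_trans (A : el2) (k : int) : transitive (@frac_eq A k).
Proof.
move=> [w y] [v x] [r z] /asboolP[u /= uE] /asboolP[s /= sE].
apply/asboolP; exists (u + s + w) => /=; rewrite !htD.
transitivity (hmul (hmul (ht s) (ht r)) (hmul (ht u) (hmul (ht w) (hin x)))).
  by rewrite (@hmul A).[AC (3*2) ((2*4)*(1*(3*5)))].
transitivity (hmul (hmul (ht u) (ht v)) (hmul (ht s) (hmul (ht r) (hin y)))).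
  by rewrite uE (@hmul A).[AC (2*(1*2)) ((3*4)*(1*(2*5)))].
by rewrite sE (@hmul A).[AC (2*(1*2)) ((1*3*4)*(2*5))].
Qed.

Canonical frac_equiv (A : el2) (k : int) :=
  EquivRel (@frac_eq A k) (@frac_eq_refl A k) (@frac_eq_sym A k)
    (@frac_eq_trans A k).

Definition loc (A : el2) (k : int) := {eq_quot @frac_eq A k}.

HB.instance Definition _ (A : el2) (k : int) :=
  Choice.copy (loc A k) {eq_quot @frac_eq A k}.
HB.instance Definition _ (A : el2) (k : int) :=
  Quotient.copy (loc A k) {eq_quot @frac_eq A k}.

Definition over (A : el2) (k : int) (v : rep A)
    (x : X (RO (int_deg A k + rep_deg v))) : loc A k :=
  \pi_(loc A k) (mk_frac x).

Lemma overW (A : el2) (k : int) (P : loc A k -> Prop) :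
  (forall v x, P (@over A k v x)) -> forall p, P p.
Proof. by move=> Pover; apply: quotW => -[v x]; exact: Pover. Qed.

Lemma over_eqP (A : el2) (k : int) (v w : rep A) x y :
  over (v := v) x = over (v := w) y :> loc A k <->
  frac_eq (mk_frac x) (mk_frac y).
Proof.
split=> [/eqP | fe]; last by apply/eqmodP.
by rewrite eqmodE.
Qed.

Ltac deg :=
  rewrite ?rep_degD ?rep_deg0; apply: I_eq => ?;
  rewrite ?(I_addE, int_degE, intrD, I_zeroE); ring.

Ltac repeq := apply/ffunP => ?; rewrite !ffunE; lia.

Definition tM (A : el2) (v : rep A) (m n : I_ A) (x : X (RO m)) : X (RO n) :=
  if rep_deg v + m =P n is ReflectT e then tmul e x else 0.

Lemma tM_linear A v m n : linear (@tM A v m n).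
Proof.
by rewrite /tM => c x y; case: eqP => [e|_]; rewrite ?linearP ?scaler0 ?addr0.
Qed.

HB.instance Definition _ A v m n :=
  GRing.isLinear.Build _ _ _ _ (@tM A v m n) (@tM_linear A v m n).

Lemma tME A v m n (e : rep_deg v + m = n :> I_ A) x : tM v n x = tmul e x.
Proof. by rewrite /tM; case: eqP => // e'; apply: tmul_eq. Qed.

Lemma tM_tmul A v w m n k (e : rep_deg w + m = n :> I_ A) x :
  tM v k (tmul e x) = tM (v + w) k x.
Proof.
rewrite /tM; case: eqP => e1; case: eqP => e2 //; first exact: tmul_tmul.
  by case: e2; rewrite rep_degD -addrA e.
by case: e1; rewrite -e addrA -rep_degD.
Qed.

Lemma tM_hin A v w m n k (x : X (RO m)) (y : X (RO n)) :
  hin x = hin y -> v = w :> rep A -> tM v k x = tM w k y.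
Proof.
move=> xy ->; have mn : m = n := congr1 tag xy.
by case: _ / mn in y xy *; rewrite (hin_inj xy).
Qed.

Lemma tM_cong A (r v w : rep A) m n (x : X (RO m)) (y : X (RO n)) :
  rep_deg v + m = rep_deg w + n ->
  (forall k, tM v k x = tM w k y) -> forall k, tM (r + v) k x = tM (r + w) k y.
Proof.
move=> e xy k; have := xy (rep_deg v + m).
rewrite (tME (erefl _)) (tME (esym e)) => xyE.
by rewrite -(tM_tmul _ _ (erefl (rep_deg v + m))) xyE tM_tmul.
Qed.

Lemma over_eqI (A : el2) (k : int) (v w : rep A) x y (u : rep A) :
  (forall n, tM (u + w) n x = tM (u + v) n y) ->
  @over A k v x = @over A k w y.
Proof.
set n := rep_deg (u + w) + (int_deg A k + rep_deg v) => /(_ n).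
have e : rep_deg (u + v) + (int_deg A k + rep_deg w) = n.
  by rewrite /n; deg.
rewrite (tME (erefl n)) (tME e) => /(congr1 (@hin A n)).
rewrite !hin_tmul !htD -!hmulA => uE.
by apply/over_eqP/asboolP; exists u.
Qed.

Lemma over_eqE (A : el2) (k : int) (v w : rep A) x y :
  @over A k v x = @over A k w y ->
  exists u : rep A, forall n, tM (u + w) n x = tM (u + v) n y.
Proof.
move=> /over_eqP/asboolP[u /= uE]; exists u => n.
have e : rep_deg (u + v) + (int_deg A k + rep_deg w) =
         rep_deg (u + w) + (int_deg A k + rep_deg v).
  by deg.
rewrite /tM; case: eqP => e1; case: eqP => e2 //.
- by apply: hin_inj; rewrite !hin_tmul !htD -!hmulA.
- by case: e2; rewrite e.
by case: e1; rewrite -e.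
Qed.

Lemma over_repr (A : el2) (k : int) (p : loc A k) :
  over (tagged (repr p)) = p.
Proof. by rewrite -[RHS]reprK /over; case: (repr p). Qed.

Lemma degD_l (A : el2) (k : int) (v w : rep A) :
  rep_deg w + (int_deg A k + rep_deg v) = int_deg A k + rep_deg (v + w).
Proof. deg. Qed.

Lemma degD_r (A : el2) (k : int) (v w : rep A) :
  rep_deg v + (int_deg A k + rep_deg w) = int_deg A k + rep_deg (v + w).
Proof. deg. Qed.

Lemma degD_mul (A : el2) (i j k : int) (e : i + j = k) (v w : rep A) :
  (int_deg A i + rep_deg v) + (int_deg A j + rep_deg w) =
  int_deg A k + rep_deg (v + w).
Proof. case: _ / e; deg. Qed.

Section GradedPiece.
Variables (A : el2) (k : int).

Definition frac_add (v w : rep A) (x : X (RO (int_deg A k + rep_deg v)))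
    (y : X (RO (int_deg A k + rep_deg w))) : loc A k :=
  over (tmul (degD_l k v w) x + tmul (degD_r k v w) y).

Definition loc_zero : loc A k := over (v := 0) 0.

Definition loc_add (p q : loc A k) : loc A k :=
  frac_add (tagged (repr p)) (tagged (repr q)).

Definition loc_opp (p : loc A k) : loc A k := over (- tagged (repr p)).

Definition loc_scale (c : 'F_2) (p : loc A k) : loc A k :=
  over (c *: tagged (repr p)).

Lemma loc_addE (v w : rep A) (x : X (RO (int_deg A k + rep_deg v)))
    (y : X (RO (int_deg A k + rep_deg w))) :
  loc_add (over x) (over y) = frac_add x y.
Proof.
rewrite /loc_add; set p := over x; set q := over y.
have /over_eqE[u uE] : over (tagged (repr p)) = over x by rewrite over_repr.
have /over_eqE[s sE] : over (tagged (repr q)) = over y by rewrite over_repr.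
move: (tag (repr p)) (tagged (repr p)) (tag (repr q)) (tagged (repr q)) uE sE.
move=> v' x' w' y' uE sE.
apply: (over_eqI (u := u + s)) => n; rewrite !linearD /= !tM_tmul.
have dx : rep_deg (u + v) + (int_deg A k + rep_deg v') =
          rep_deg (u + v') + (int_deg A k + rep_deg v) by deg.
have dy : rep_deg (s + w) + (int_deg A k + rep_deg w') =
          rep_deg (s + w') + (int_deg A k + rep_deg w) by deg.
congr (_ + _).
  have := tM_cong (s + w + w') dx uE n.
  rewrite (_ : _ + _ = u + s + (v + w) + w'); last by repeq.
  by move=> ->; apply: tM_hin => //; repeq.
have := tM_cong (u + v + v') dy sE n.
rewrite (_ : _ + _ = u + s + (v + w) + v'); last by repeq.
by move=> ->; apply: tM_hin => //; repeq.
Qed.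

Lemma over_ext (h : forall m : I_ A, X (RO m) -> X (RO m)) :
  (forall (u : rep A) m n z, tM u n (h m z) = h n (tM u n z)) ->
  forall (v w : rep A) (x : X (RO (int_deg A k + rep_deg v)))
    (y : X (RO (int_deg A k + rep_deg w))),
  over x = over y -> over (h _ x) = over (h _ y).
Proof.
move=> hP v w x y /over_eqE[u uE].
by apply: (over_eqI (u := u)) => n; rewrite !hP uE.
Qed.

Lemma loc_oppE (v : rep A) (x : X (RO (int_deg A k + rep_deg v))) :
  loc_opp (over x) = over (- x).
Proof.
apply: (over_ext (h := fun m z => - z)); last exact: over_repr.
by move=> u m n z; rewrite linearN.
Qed.

Lemma loc_scaleE (c : 'F_2) (v : rep A)
    (x : X (RO (int_deg A k + rep_deg v))) :
  loc_scale c (over x) = over (c *: x).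
Proof.
apply: (over_ext (h := fun m z => c *: z)); last exact: over_repr.
by move=> u m n z; rewrite linearZ.
Qed.

Lemma loc_addA : associative loc_add.
Proof.
elim/overW=> v x; elim/overW=> w y; elim/overW=> z r.
rewrite (loc_addE y r) (loc_addE x y) /frac_add !loc_addE /frac_add.
apply: (over_eqI (u := 0)) => n; rewrite !linearD /= !tM_tmul addrA.
by congr (_ + _ + _); apply: tM_hin => //; repeq.
Qed.

Lemma loc_addC : commutative loc_add.
Proof.
elim/overW=> v x; elim/overW=> w y; rewrite !loc_addE /frac_add.
apply: (over_eqI (u := 0)) => n; rewrite !linearD /= !tM_tmul addrC.
by congr (_ + _); apply: tM_hin => //; repeq.
Qed.

Lemma loc_add0 : left_id loc_zero loc_add.
Proof.
elim/overW=> v x; rewrite loc_addE /frac_add.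
apply: (over_eqI (u := 0)) => n.
rewrite !linearD /= !tM_tmul linear0 [LHS]add0r.
by apply: tM_hin => //; repeq.
Qed.

Lemma loc_addN : left_inverse loc_zero loc_opp loc_add.
Proof.
elim/overW=> v x; rewrite loc_oppE loc_addE /frac_add.
apply: (over_eqI (u := 0)) => n; rewrite !linearD /= !tM_tmul.
rewrite linearN linear0 -[RHS](addNr (tM (0 + 0 + v) n x)).
by congr (- _ + _); apply: tM_hin => //; repeq.
Qed.

HB.instance Definition _ := GRing.isZmodule.Build (loc A k)
  loc_addA loc_addC loc_add0 loc_addN.

Lemma over_add (v w : rep A) (x : X (RO (int_deg A k + rep_deg v)))
    (y : X (RO (int_deg A k + rep_deg w))) :
  over x + over y = frac_add x y.
Proof. exact: loc_addE. Qed.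

Lemma loc_scaleA c d p : loc_scale c (loc_scale d p) = loc_scale (c * d) p.
Proof. by elim/overW: p => v x; rewrite !loc_scaleE scalerA. Qed.

Lemma loc_scale1 : left_id 1 loc_scale.
Proof. by elim/overW=> v x; rewrite loc_scaleE scale1r. Qed.

Lemma loc_scaleDr : right_distributive loc_scale +%R.
Proof.
move=> c; elim/overW=> v x; elim/overW=> w y.
rewrite (loc_scaleE c x) (loc_scaleE c y) !over_add /frac_add loc_scaleE.
by congr over; rewrite scalerDr !linearZ.
Qed.

Lemma loc_scaleDl p : {morph loc_scale^~ p : c d / c + d}.
Proof.
move=> c d; elim/overW: p => v x; rewrite (loc_scaleE c x) (loc_scaleE d x) loc_scaleE over_add /frac_add.
apply: (over_eqI (u := 0)) => n; rewrite !linearD /= !tM_tmul.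
rewrite scalerDl linearD !linearZ /=.
by congr (_ *: _ + _ *: _); apply: tM_hin => //; repeq.
Qed.

HB.instance Definition _ := GRing.Zmodule_isLmodule.Build 'F_2 (loc A k)
  loc_scaleA loc_scale1 loc_scaleDr loc_scaleDl.

Lemma over_scale (c : 'F_2) (v : rep A)
    (x : X (RO (int_deg A k + rep_deg v))) :
  c *: over x = over (c *: x).
Proof. exact: loc_scaleE. Qed.

End GradedPiece.

Section Multiplication.
Variable A : el2.

Definition frac_mul (i j k : int) (e : i + j = k) (v w : rep A)
    (x : X (RO (int_deg A i + rep_deg v)))
    (y : X (RO (int_deg A j + rep_deg w))) : loc A k :=
  over (mul (degD_mul e v w) x y).

Definition loc_mul (i j k : int) (e : i + j = k) (p : loc A i) (q : loc A j) :
  loc A k := frac_mul e (tagged (repr p)) (tagged (repr q)).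

Lemma one_deg : 0 = int_deg A 0 + rep_deg 0.
Proof. by deg. Qed.

Definition loc_one : loc A 0 := over (ecast m (X (RO m)) one_deg (one X A)).

Lemma hin_one : hin (ecast m (X (RO m)) one_deg (one X A)) = hone A.
Proof. by case: _ / one_deg. Qed.

Lemma loc_mulE (i j k : int) (e : i + j = k) (v w : rep A)
    (x : X (RO (int_deg A i + rep_deg v)))
    (y : X (RO (int_deg A j + rep_deg w))) :
  loc_mul e (over x) (over y) = frac_mul e x y.
Proof.
rewrite /loc_mul; set p := over x; set q := over y.
have := over_repr p; have := over_repr q; rewrite {}/p {}/q.
move: (tag (repr (over x))) (tagged (repr (over x))) => v' x'.
move: (tag (repr (over y))) (tagged (repr (over y))) => w' y'.
move=> /over_eqP/asboolP[s /= sE] /over_eqP/asboolP[u /= uE].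
apply/over_eqP/asboolP; exists (u + s) => /=; rewrite !hin_mul !htD.
transitivity (hmul (hmul (ht u) (hmul (ht v) (hin x')))
                   (hmul (ht s) (hmul (ht w) (hin y')))).
  by rewrite (@hmul A).[AC (2*(2*2)) ((1*(3*5))*(2*(4*6)))].
rewrite uE sE.
by rewrite (@hmul A).[AC ((1*2)*(1*2)) ((1*4)*((2*5)*(3*6)))].
Qed.

Lemma over_hin (k : int) (v w : rep A)
    (x : X (RO (int_deg A k + rep_deg v)))
    (y : X (RO (int_deg A k + rep_deg w))) :
  v = w -> hin x = hin y -> over x = over y.
Proof.
by move=> vw xy; apply/over_eqP/asboolP; exists 0; rewrite /= xy vw.
Qed.

Lemma loc_mulA (i j l ij jl k : int) (e1 : i + jl = k) (e2 : j + l = jl)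
    (e3 : ij + l = k) (e4 : i + j = ij) p q r :
  loc_mul e1 p (loc_mul e2 q r) = loc_mul e3 (loc_mul e4 p q) r.
Proof.
elim/overW: p => v x; elim/overW: q => w y; elim/overW: r => z r.
rewrite (loc_mulE e2 y r) (loc_mulE e4 x y) /frac_mul !loc_mulE /frac_mul.
by apply: over_hin; [exact: addrA | rewrite !hin_mul hmulA].
Qed.

Lemma loc_mulC (i j k : int) (e : i + j = k) (e' : j + i = k) p q :
  loc_mul e p q = loc_mul e' q p.
Proof.
elim/overW: p => v x; elim/overW: q => w y; rewrite !loc_mulE.
by apply: over_hin; [exact: addrC | rewrite !hin_mul hmulC].
Qed.

Lemma loc_mul1x (i : int) (e : 0 + i = i) p : loc_mul e loc_one p = p.
Proof.
elim/overW: p => v x; rewrite loc_mulE.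
by apply: over_hin; [exact: add0r | rewrite hin_mul hin_one hmul1x].
Qed.

Lemma tM_mul (v w : rep A) m n p k l (e1 : m + n = k) (e : rep_deg w + p = m)
    x y :
  tM v l (mul e1 (tmul e x) y) = tM (v + w) l (mul (erefl (p + n)) x y).
Proof.
have e2 : rep_deg w + (p + n) = k by rewrite addrA e.
rewrite -(tM_tmul _ _ e2); congr tM; apply: hin_inj.
by rewrite hin_mul !hin_tmul hin_mul hmulA.
Qed.

Lemma tM_mul_erefl (v : rep A) m n k l (e : m + n = k :> I_ A) x y :
  tM v l (mul e x y) = tM v l (mul (erefl (m + n)) x y).
Proof. by case: _ / e. Qed.

Lemma loc_mul_linearr (i j k : int) (e : i + j = k) (p : loc A i) :
  linear (loc_mul e p).
Proof.
move=> c q r; rewrite !(loc_mulC e (etrans (addrC j i) e)).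
move: (etrans _ _) => {}e.
elim/overW: p => z s; elim/overW: q => v x; elim/overW: r => w y.
rewrite (over_scale c x) over_add /frac_add.
rewrite (loc_mulE e x s) (loc_mulE e y s) loc_mulE /frac_mul.
rewrite (over_scale c (mul _ x s)) over_add /frac_add.
apply: (over_eqI (u := 0)) => n.
rewrite [tmul _ (c *: x)]linearZ mulDl mulZl.
rewrite linearD [in RHS]linearD /=.
rewrite tM_tmul tM_tmul.
rewrite linearZ [in RHS]linearZ /=.
rewrite (tM_mul _ _ (degD_mul e (v + w) z)) (tM_mul _ _ (degD_mul e (v + w) z)).
by congr (_ *: _ + _); apply: tM_hin; rewrite ?hin_mul //; repeq.
Qed.

Lemma loc_mul_linearl (i j k : int) (e : i + j = k) (q : loc A j) :
  linear (fun p : loc A i => loc_mul e p q).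
Proof.
move=> c p r; rewrite ![loc_mul e _ q](loc_mulC e (etrans (addrC j i) e)).
exact: loc_mul_linearr.
Qed.

End Multiplication.

Definition rep_pull (B A : el2) (f : el2_hom B A) (v : rep A) : rep B :=
  [ffun mu => (\sum_(l | chr_pull f l == mu) v l)%N].

Lemma rep_pullD (B A : el2) (f : el2_hom B A) (v w : rep A) :
  rep_pull f (v + w) = rep_pull f v + rep_pull f w.
Proof.
apply/ffunP => mu; rewrite !ffunE -[RHS]big_split.
by apply: eq_bigr => l _; rewrite ffunE.
Qed.

Lemma rep_pull0 (B A : el2) (f : el2_hom B A) : rep_pull f 0 = 0.
Proof. by apply/ffunP => mu; rewrite !ffunE big1 // => l _; rewrite ffunE. Qed.

Lemma rep_pull_id (A : el2) (v : rep A) : rep_pull (id_hom A) v = v.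
Proof.
apply/ffunP => mu; rewrite ffunE (big_pred1 mu) // => l /=.
by congr (_ == _); apply: chr_eq => x; rewrite chr_pullE.
Qed.

Lemma rep_pull_comp (D B A : el2) (f : el2_hom B A) (g : el2_hom D B)
  (v : rep A) : rep_pull (comp_hom f g) v = rep_pull g (rep_pull f v).
Proof.
apply/ffunP => mu; rewrite !ffunE.
rewrite (partition_big (chr_pull f) (fun nu => chr_pull g nu == mu)) /=.
  apply: eq_bigr => nu /eqP nuE; rewrite ffunE; apply: eq_bigl => l.
  apply: andb_idl => /eqP lE; apply/eqP; rewrite -nuE -lE.
  by apply: chr_eq => x; rewrite !chr_pullE.
move=> l /eqP <-; apply/eqP.
by apply: chr_eq => x; rewrite !chr_pullE.
Qed.

Lemma pull_sum (B A : el2) (f : el2_hom B A) (v : rep A) :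
  pull f (rep_deg v) = rep_deg (rep_pull f v).
Proof.
rewrite /rep_deg (big_morph (pull f) (pullD f) (pull0 f)).
rewrite (partition_big (chr_pull f) xpredT) //=; apply: eq_bigr => mu _.
rewrite ffunE -sumrMnr; apply: eq_bigr => l /eqP <-.
by elim: (v l) => [|n IH]; rewrite ?pull0 // !mulrS pullD IH pull_thom.
Qed.

Definition hres (B A : el2) (f : el2_hom B A) (x : hel A) : hel B :=
  hin (res X (erefl (pull f (tag x))) (tagged x)).

Lemma hres_hin (B A : el2) (f : el2_hom B A) m n (e : pull f m = n) x :
  hin (res X e x) = hres f (hin x).
Proof. by case: _ / e. Qed.

Lemma hres_mul (B A : el2) (f : el2_hom B A) :
  {morph hres f : x y / hmul x y >-> hmul x y}.
Proof.
move=> [m x] [n y].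
rewrite -[hmul _ _](hin_mul (erefl (m + n)) x y) -(hres_hin (pullD f m n)).
by rewrite (res_mul (erefl _) (erefl _) (pullD f m n) erefl erefl) hin_mul.
Qed.

Lemma hres_one (B A : el2) (f : el2_hom B A) : hres f (hone A) = hone B.
Proof. by rewrite -(hres_hin (pull0 f)) res_one. Qed.

Lemma res_t_chr (B A : el2) (f : el2_hom B A) (l : chr A)
    (e : pull f (thom_deg l) = thom_deg (chr_pull f l)) :
  res X e (t_chr t l) = t_chr t (chr_pull f l).
Proof. by apply: res_comp => x; rewrite /= ffunE. Qed.

Lemma hres_ht (B A : el2) (f : el2_hom B A) (v : rep A) :
  hres f (ht v) = ht (rep_pull f v).
Proof.
rewrite /ht (big_morph (hres f) (hres_mul f) (hres_one f)).
rewrite (partition_big (chr_pull f) xpredT) //=; apply: eq_bigr => mu _.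
rewrite ffunE (big_morph (hexp _) (hexpD _) (erefl _)).
apply: eq_bigr => l /eqP <-.
elim: (v l) => [|n IH]; first by rewrite hres_one.
rewrite /hexp !iterS -!/(hexp _ _) hres_mul IH -(hres_hin (pull_thom f l)).
by rewrite res_t_chr.
Qed.

Lemma hres_comp (D B A : el2) (f : el2_hom B A) (g : el2_hom D B) x :
  hres (comp_hom f g) x = hres g (hres f x).
Proof.
case: x => m x; rewrite -[existT _ _ _]/(hin x).
rewrite -(hres_hin (pull_comp f g m)) -(hres_hin (erefl (pull f m))).
rewrite -(hres_hin (erefl (pull g (pull f m)))); congr hin.
by symmetry; apply: res_comp.
Qed.

Section Restriction.
Variables (B A : el2) (f : el2_hom B A).

Lemma res_deg (k : int) (v : rep A) :
  pull f (int_deg A k + rep_deg v) = int_deg B k + rep_deg (rep_pull f v).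
Proof. by rewrite pullD pull_int pull_sum. Qed.

Definition frac_res (k : int) (v : rep A)
    (x : X (RO (int_deg A k + rep_deg v))) : loc B k :=
  over (res X (res_deg k v) x).

Definition loc_res (k : int) (p : loc A k) : loc B k :=
  frac_res (tagged (repr p)).

Lemma loc_resE (k : int) (v : rep A) (x : X (RO (int_deg A k + rep_deg v))) :
  loc_res (over x) = frac_res x.
Proof.
rewrite /loc_res; have := over_repr (over x).
move: (tag (repr (over x))) (tagged (repr (over x))) => w y.
move=> /over_eqP/asboolP[u /= uE]; apply/over_eqP/asboolP.
exists (rep_pull f u) => /=.
by rewrite !hres_hin -!hres_ht -!hres_mul uE.
Qed.

Lemma loc_res_linear (k : int) : linear (@loc_res k).
Proof.
move=> c; elim/overW=> v x; elim/overW=> w y.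
rewrite (over_scale c x) over_add /frac_add.
rewrite (loc_resE x) (loc_resE y) loc_resE /frac_res.
rewrite (over_scale c (res _ _ x)) over_add /frac_add.
have vw := rep_pullD f v w.
apply: over_hin => //.
have eD : pull f (int_deg A k + rep_deg (v + w)) =
  int_deg B k + rep_deg (rep_pull f v + rep_pull f w).
  by rewrite res_deg vw.
transitivity (hin (res X eD (tmul (degD_l k v w) (c *: x) +
                             tmul (degD_r k v w) y))).
  by rewrite !hres_hin.
congr hin; rewrite linearD; congr (_ + _); apply: hin_inj.
  rewrite hres_hin !hin_tmul hres_mul hres_ht -(hres_hin (res_deg k v)).
  by rewrite linearZ.
by rewrite hres_hin !hin_tmul hres_mul hres_ht -(hres_hin (res_deg k w)).
Qed.

HB.instance Definition _ (k : int) :=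
  GRing.isLinear.Build _ _ _ _ (@loc_res k) (@loc_res_linear k).

Lemma loc_res_mul (i j k : int) (e : i + j = k) p q :
  loc_res (loc_mul e p q) = loc_mul e (loc_res p) (loc_res q).
Proof.
elim/overW: p => v x; elim/overW: q => w y.
rewrite (loc_resE x) (loc_resE y) !loc_mulE loc_resE.
apply: over_hin; first exact: rep_pullD.
by rewrite hres_hin !hin_mul hres_mul !hres_hin.
Qed.

Lemma loc_res_one : loc_res (loc_one A) = loc_one B.
Proof.
rewrite loc_resE; apply: over_hin; first exact: rep_pull0.
by rewrite hres_hin !hin_one hres_one.
Qed.

End Restriction.

Definition loc_gralg (A : el2) : gralg :=
  MkGrAlg (gr_obj := fun k => loc A k : lmodType 'F_2)
    (@loc_mul_linearl A) (@loc_mul_linearr A) (@loc_mulA A) (@loc_mulC A)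
    (@loc_mul1x A).

Definition loc_gr_hom (B A : el2) (f : el2_hom B A) :
  gr_hom (loc_gralg A) (loc_gralg B) :=
  @MkGrHom (loc_gralg A) (loc_gralg B)
    (fun k => @loc_res B A f k : {linear loc_gralg A k -> loc_gralg B k})
    (@loc_res_mul B A f) (loc_res_one f).

Lemma loc_res_id (A : el2) (k : int) (p : loc A k) :
  loc_res (id_hom A) p = p.
Proof.
elim/overW: p => v x; rewrite loc_resE.
apply: over_hin; first exact: rep_pull_id.
by rewrite hres_hin -(hres_hin (pull_id _)) res_id.
Qed.

Lemma loc_res_comp (D B A : el2) (f : el2_hom B A) (g : el2_hom D B) (k : int)
  (p : loc A k) : loc_res (comp_hom f g) p = loc_res g (loc_res f p).
Proof.
elim/overW: p => v x; rewrite (loc_resE f x) !loc_resE.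
apply: over_hin; first exact: rep_pull_comp.
by rewrite !hres_hin hres_comp.
Qed.

Definition loc_alg : el2_alg :=
  MkEl2Alg (ea_map := loc_gr_hom) loc_res_id loc_res_comp.

Definition rep_chr (A : el2) (l : chr A) : rep A :=
  [ffun mu => nat_of_bool (mu == l)].

Lemma over_a_deg :
  neg_chr sigma = int_deg C (- 1) + rep_deg (rep_chr sigma).
Proof.
rewrite /rep_deg (bigD1 sigma) //= big1 => [|l /negbTE nl]; last first.
  by rewrite ffunE nl.
rewrite ffunE eqxx mulr1n addr0 /thom_deg addrA.
apply: I_eq => x; rewrite !(I_addE, int_degE).
by rewrite mulrN1z mulr1z addNr add0r.
Qed.

Definition a_over_t (a : X (RO (neg_chr sigma))) : loc_alg C (- 1) :=
  over (ecast m (X (RO m)) over_a_deg a).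

End Localization.

Section LocalizationMap.
Variables (X Y : el2RO_alg) (f : alg_hom X Y).
Variables (t : X (RO (thom_deg sigma))) (s : Y (RO (thom_deg sigma))).
Hypothesis fts : f _ t = s.

Definition hmap (A : el2) (x : hel X A) : hel Y A := hin (f _ (tagged x)).

Lemma hmap_hin (A : el2) (m : I_ A) (x : X (RO m)) :
  hin (f _ x) = hmap (hin x).
Proof. by []. Qed.

Lemma ah_res (B A : el2) (g : el2_hom B A) m n (e : pull g m = n) x :
  f _ (res X e x) = res Y e (f _ x).
Proof. exact: ah_natural. Qed.

Lemma ah_mul (A : el2) (m n k : I_ A) (e : m + n = k) x y :
  f _ (mul e x y) = mul e (f _ x) (f _ y).
Proof. by rewrite /mul ah_natural ah_pair. Qed.

Lemma hmap_mul (A : el2) : {morph @hmap A : x y / hmul x y >-> hmul x y}.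
Proof. by move=> [m x] [n y]; rewrite /hmap /hmul /= ah_mul. Qed.

Lemma hmap_one (A : el2) : hmap (hone X A) = hone Y A.
Proof. by rewrite /hmap /= /one ah_res ah_one. Qed.

Lemma hmap_ht (A : el2) (v : rep A) : hmap (ht t v) = ht s v.
Proof.
rewrite /ht (big_morph (@hmap A) (@hmap_mul A) (hmap_one A)).
apply: eq_bigr => l _; elim: (v l) => [|n IH]; first by rewrite hmap_one.
rewrite /hexp !iterS -!/(hexp _ _) hmap_mul IH; congr hmul.
by rewrite -hmap_hin /t_chr ah_res fts.
Qed.

Definition loc_map (A : el2) (k : int) (p : loc t A k) : loc s A k :=
  over s (f _ (tagged (repr p))).

Lemma loc_mapE (A : el2) (k : int) (v : rep A)
    (x : X (RO (int_deg A k + rep_deg v))) :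
  loc_map (over t x) = over s (f _ x).
Proof.
rewrite /loc_map; have := over_repr (over t x).
move: (tag (repr (over t x))) (tagged (repr (over t x))) => w y.
move=> /over_eqP/asboolP[u /= uE]; apply/over_eqP/asboolP.
by exists u => /=; rewrite !hmap_hin -!hmap_ht -!hmap_mul uE.
Qed.

Lemma loc_map_linear (A : el2) (k : int) : linear (@loc_map A k).
Proof.
move=> c; elim/overW=> v x; elim/overW=> w y.
rewrite (over_scale _ c x) over_add /frac_add.
rewrite (loc_mapE x) (loc_mapE y) loc_mapE.
rewrite (over_scale _ c (f _ x)) over_add /frac_add.
congr over; rewrite linearD; congr (_ + _); apply: hin_inj.
  by rewrite hmap_hin !hin_tmul hmap_mul hmap_ht -hmap_hin linearZ.
by rewrite hmap_hin !hin_tmul hmap_mul hmap_ht.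
Qed.

HB.instance Definition _ (A : el2) (k : int) :=
  GRing.isLinear.Build _ _ _ _ (@loc_map A k) (@loc_map_linear A k).

Lemma loc_map_mul (A : el2) (i j k : int) (e : i + j = k) p q :
  @loc_map A k (loc_mul e p q) = loc_mul e (loc_map p) (loc_map q).
Proof.
elim/overW: p => v x; elim/overW: q => w y.
rewrite (loc_mapE x) (loc_mapE y) !loc_mulE loc_mapE.
by apply: over_hin; rewrite // ah_mul.
Qed.

Lemma loc_map_one (A : el2) : loc_map (loc_one t A) = loc_one s A.
Proof.
rewrite loc_mapE; apply: over_hin => //.
by rewrite hmap_hin !hin_one hmap_one.
Qed.

Lemma loc_map_res (B A : el2) (g : el2_hom B A) (k : int) (p : loc t A k) :
  loc_map (loc_res g p) = loc_res g (loc_map p).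
Proof.
elim/overW: p => v x; rewrite (loc_resE _ g x) (loc_mapE x) loc_mapE loc_resE.
by apply: over_hin; rewrite // ah_res.
Qed.

Definition loc_map_hom (A : el2) : gr_hom (loc_alg t A) (loc_alg s A) :=
  @MkGrHom (loc_alg t A) (loc_alg s A)
    (fun k => @loc_map A k : {linear loc_alg t A k -> loc_alg s A k})
    (@loc_map_mul A) (loc_map_one A).

Lemma loc_map_a (a : X (RO (neg_chr sigma))) (b : Y (RO (neg_chr sigma))) :
  f _ a = b -> loc_map (a_over_t t a) = a_over_t s b.
Proof.
move=> <-; rewrite loc_mapE; apply: over_hin => //.
by case: _ / over_a_deg.
Qed.

End LocalizationMap.

Record category := Category {
  cat_obj :> Type;
  cat_hom : cat_obj -> cat_obj -> Type;
  cat_id : forall x, cat_hom x x;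
  cat_comp : forall x y z, cat_hom y z -> cat_hom x y -> cat_hom x z;
  cat_comp1m : forall x y (f : cat_hom x y), cat_comp (cat_id y) f = f;
  cat_compm1 : forall x y (f : cat_hom x y), cat_comp f (cat_id x) = f;
  cat_compA : forall x y z w (f : cat_hom z w) (g : cat_hom y z)
    (h : cat_hom x y), cat_comp f (cat_comp g h) = cat_comp (cat_comp f g) h
}.

Record functor (D E : category) := Functor {
  fobj :> D -> E;
  fmap : forall x y : D, cat_hom x y -> cat_hom (fobj x) (fobj y);
  fmap_id : forall x, fmap (cat_id x) = cat_id (fobj x);
  fmap_comp : forall (x y z : D) (f : cat_hom y z) (g : cat_hom x y),
    fmap (cat_comp f g) = cat_comp (fmap f) (fmap g)
}.

Definition right_adjoint (D E : category) (F : functor D E) (G : functor E D) :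
  Prop :=
  exists phi : forall (x : D) (y : E), cat_hom (F x) y -> cat_hom x (G y),
    [/\ forall x y, bijective (phi x y),
        forall x x' y (f : cat_hom x' x) (g : cat_hom (F x) y),
          phi x' y (cat_comp g (fmap F f)) = cat_comp (phi x y g) f
      & forall x y y' (f : cat_hom y y') (g : cat_hom (F x) y),
          phi x y' (cat_comp f g) = cat_comp (fmap G f) (phi x y g)].

Definition fully_faithful (D E : category) (F : functor D E) : Prop :=
  forall x y : D, bijective (@fmap D E F x y).

Definition isomorphic (D : category) (x y : D) : Prop :=
  exists (f : cat_hom x y) (g : cat_hom y x),
    cat_comp f g = cat_id y /\ cat_comp g f = cat_id x.

Definition essential_image (D E : category) (F : functor D E) (y : E) : Prop :=
  exists x : D, isomorphic (F x) y.

Lemma linear_eq (U V : lmodType 'F_2) (f g : {linear U -> V}) :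
  f =1 g -> f = g.
Proof.
case: f g => [f cf] [g cg] /= fg; have {}fg := funext fg; subst g.
case: cf cg => [[f1] [f2]] [[g1] [g2]].
by rewrite (Prop_irrelevance f1 g1) (Prop_irrelevance f2 g2).
Qed.

Lemma oriented_hom_eq (X Y : oriented) (f g : oriented_hom X Y) :
  (forall P, f P =1 g P) -> f = g.
Proof.
case: f g => [[f f1 f2 f3] fa ft] [[g g1 g2 g3] ga gt] /= fg.
have E : f = g by apply: functional_extensionality_dep => P; apply/linear_eq/fg.
subst g; move: ga gt.
rewrite (Prop_irrelevance g1 f1) (Prop_irrelevance g2 f2).
rewrite (Prop_irrelevance g3 f3) => ga gt.
by rewrite (Prop_irrelevance ga fa) (Prop_irrelevance gt ft).
Qed.

Definition alg_hom_id (X : el2RO_alg) : alg_hom X X :=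
  @MkAlgHom X X (fun P => idfun : {linear X P -> X P})
    (fun _ _ _ _ => erefl) (fun _ _ _ _ => erefl) erefl.

Section AlgHomComp.
Variables (X Y Z : el2RO_alg) (f : alg_hom Y Z) (g : alg_hom X Y).

Definition alg_hom_comp_fun (P : el2RO) : {linear X P -> Z P} := f P \o g P.

Lemma alg_hom_comp_natural (P Q : el2RO) (h : RO_hom P Q) (x : X Q) :
  alg_hom_comp_fun P (alg_map X h x) = alg_map Z h (alg_hom_comp_fun Q x).
Proof. by rewrite /= !ah_natural. Qed.

Lemma alg_hom_comp_pair (P Q : el2RO) (x : X P) (y : X Q) :
  alg_hom_comp_fun _ (alg_pair x y) =
  alg_pair (alg_hom_comp_fun P x) (alg_hom_comp_fun Q y).
Proof. by rewrite /= !ah_pair. Qed.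

Lemma alg_hom_comp_one : alg_hom_comp_fun RO_unit (alg_one X) = alg_one Z.
Proof. by rewrite /= !ah_one. Qed.

Definition alg_hom_comp : alg_hom X Z :=
  MkAlgHom alg_hom_comp_natural alg_hom_comp_pair alg_hom_comp_one.

End AlgHomComp.

Definition oriented_hom_id (X : oriented) : oriented_hom X X :=
  @MkOrientedHom X X (alg_hom_id X) erefl erefl.

Section OrientedHomComp.
Variables (X Y Z : oriented) (f : oriented_hom Y Z) (g : oriented_hom X Y).

Lemma oriented_hom_comp_a : alg_hom_comp f g _ (or_a X) = or_a Z.
Proof. by rewrite /= !oh_a. Qed.

Lemma oriented_hom_comp_t : alg_hom_comp f g _ (or_t X) = or_t Z.
Proof. by rewrite /= !oh_t. Qed.

Definition oriented_hom_comp : oriented_hom X Z :=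
  MkOrientedHom oriented_hom_comp_a oriented_hom_comp_t.

End OrientedHomComp.

Definition oriented_cat : category.
Proof.
refine (@Category oriented oriented_hom oriented_hom_id oriented_hom_comp
  _ _ _).
- by move=> X Y f; apply: oriented_hom_eq.
- by move=> X Y f; apply: oriented_hom_eq.
- by move=> X Y Z W f g h; apply: oriented_hom_eq.
Defined.

Lemma group_law_hom_eq (G H : group_law) (f g : group_law_hom G H) :
  (forall A k, f A k =1 g A k) -> f = g.
Proof.
case: f g => [f fn fe] [g gn ge] /= fg.
have E : f = g.
  apply: functional_extensionality_dep => A; move: (fg A).
  case: (f A) (g A) => [h h1 h2] [h' h1' h2'] /= hh'.
  have E : h = h'.
    by apply: functional_extensionality_dep => k; apply/linear_eq/hh'.
  subst h'.
  by rewrite (Prop_irrelevance h1 h1') (Prop_irrelevance h2 h2').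
by subst g; rewrite (Prop_irrelevance fn gn) (Prop_irrelevance fe ge).
Qed.

Definition gr_hom_id (G : gralg) : gr_hom G G :=
  @MkGrHom G G (fun k => idfun : {linear G k -> G k})
    (fun _ _ _ _ _ _ => erefl) erefl.

Section GrHomComp.
Variables (G H K : gralg) (f : gr_hom H K) (g : gr_hom G H).

Definition gr_hom_comp_fun (k : int) : {linear G k -> K k} := f k \o g k.

Lemma gr_hom_comp_mul (i j k : int) (e : i + j = k) x y :
  gr_hom_comp_fun k (gr_mul e x y) =
  gr_mul e (gr_hom_comp_fun i x) (gr_hom_comp_fun j y).
Proof. by rewrite /= !gh_mul. Qed.

Lemma gr_hom_comp_one : gr_hom_comp_fun 0 (gr_one G) = gr_one K.
Proof. by rewrite /= !gh_one. Qed.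

Definition gr_hom_comp : gr_hom G K := MkGrHom gr_hom_comp_mul gr_hom_comp_one.

End GrHomComp.

Definition group_law_hom_id (G : group_law) : group_law_hom G G :=
  @MkGroupLawHom G G (fun A => gr_hom_id (G A)) (fun _ _ _ _ _ => erefl) erefl.

Section GroupLawHomComp.
Variables (G H K : group_law) (f : group_law_hom H K) (g : group_law_hom G H).

Lemma group_law_hom_comp_natural (B A : el2) (h : el2_hom B A) (k : int) x :
  gr_hom_comp (f B) (g B) k (ea_map G h k x) =
  ea_map K h k (gr_hom_comp (f A) (g A) k x).
Proof. by rewrite /= !glh_natural. Qed.

Lemma group_law_hom_comp_e :
  gr_hom_comp (f C) (g C) (- 1) (gl_e G) = gl_e K.
Proof. by rewrite /= !glh_e. Qed.

Definition group_law_hom_comp : group_law_hom G K :=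
  MkGroupLawHom group_law_hom_comp_natural group_law_hom_comp_e.

End GroupLawHomComp.

Definition group_law_cat : category.
Proof.
refine (@Category group_law group_law_hom group_law_hom_id group_law_hom_comp
  _ _ _).
- by move=> X Y f; apply: group_law_hom_eq.
- by move=> X Y f; apply: group_law_hom_eq.
- by move=> X Y Z W f g h; apply: group_law_hom_eq.
Defined.

Definition t_inv (X : oriented) : el2_alg := loc_alg (or_t X).

Definition t_inv_e (X : oriented) : t_inv X C (- 1) := a_over_t (or_t X) (or_a X).

Section Functor.
Hypothesis coord : forall X : oriented, is_coordinate (t_inv_e X).

Definition t_inv_obj (X : oriented_cat) : group_law_cat :=
  @GroupLaw (t_inv X) (t_inv_e X) (coord X).

Definition t_inv_map (X Y : oriented_cat) (f : cat_hom X Y) :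
  cat_hom (t_inv_obj X) (t_inv_obj Y) :=
  @MkGroupLawHom (t_inv_obj X) (t_inv_obj Y) (loc_map_hom (oh_t f))
    (@loc_map_res _ _ _ _ _ (oh_t f)) (loc_map_a (oh_t f) (oh_a f)).

Lemma t_inv_map_id X : t_inv_map (cat_id X) = cat_id (t_inv_obj X).
Proof.
apply: group_law_hom_eq => A k; elim/overW=> v x.
exact: loc_mapE.
Qed.

Lemma t_inv_map_comp (X Y Z : oriented_cat) (f : cat_hom Y Z)
    (g : cat_hom X Y) :
  t_inv_map (cat_comp f g) = cat_comp (t_inv_map f) (t_inv_map g).
Proof.
apply: group_law_hom_eq => A k; elim/overW=> v x /=.
rewrite (loc_mapE (oh_t g) x) (loc_mapE (oh_t f)).
exact: (loc_mapE (oh_t (oriented_hom_comp f g))).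
Qed.

Definition t_inv_functor : functor oriented_cat group_law_cat :=
  Functor t_inv_map_id t_inv_map_comp.

End Functor.

End RepresentationRing.

(* Main.v *)
(* Evaluation at the identity gives a degree |m| in Z for every m in I_A, and
   every m is |m| + (dim V - V) with V unique up to trivial summands.  The right
   adjoint sends a group law G to (A, m) |-> G(A)_|m| with a = e and t = 1; the
   unit of the adjunction is x |-> x / t_V and its counit is an isomorphism, so
   that the right adjoint is fully faithful, and X lies in its essential image
   exactly when division by all t_V is already possible in X.  For the
   coordinate a / t, a retraction A -> K lifts denominators from the kernel K
   to A, and one extra factor t_lambda keeps degrees inside I_A. *)
From HB Require Import structures.
From mathcomp Require Import all_boot all_order all_algebra all_fingroup.
From mathcomp Require Import generic_quotient abelian mxrepresentation.
From mathcomp Require Import boolp reals.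
From mathcomp Require Import ring.
Require Import Defs.

Set Implicit Arguments.
Unset Strict Implicit.
Unset Printing Implicit Defensive.

Import Order.TTheory GRing.Theory Num.Theory.
Local Open Scope quotient_scope.
Local Open Scope ring_scope.

(** The obstacle in the coordinate property is that I_A is a monoid and not a group: for m in I_A
    the degree m + l may leave I_A, so orientability says nothing about an arbitrary numerator.
    Moreover, equality of fractions holds only after multiplication by some t_U, and for fractions
    over K this U is a representation of K alone. The regrading works because evaluation at 1 is
    additive and unchanged by pullback, so that lax monoidality is inherited from G. All t_V have
    dimension 0 and become 1 in it, so a fraction over the regraded algebra carries no more than its
    numerator; this makes the counit invertible, and the statements about the right adjoint become
    formal. The freedom to add trivial summands to V is harmless because the inverse Thom condition
    makes t of the trivial character equal to 1. Degrees often agree only provably. Identities are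
    therefore mostly proved in the total spaces [hel] and [gel], where products form commutative
    monoids and transports disappear. *)

Lemma oppr1_neq1 (F : numFieldType) : -1 != 1 :> F.
Proof. by rewrite -subr_eq0 -opprD oppr_eq0 (_ : 1 + 1 = 2%:R) ?pnatr_eq0. Qed.

(** The two summands (1 + A)/2 and (1 - A)/2 of the identity have their rows in the eigenspaces for
    1 and -1. *)
Lemma involution_diagonalizable (F : numFieldType) n (A : 'M[F]_n) :
  A *m A = 1%:M -> diagonalizable A.
Proof.
move=> A2; apply/diagonalizablePeigen; exists [:: 1; -1].
  by rewrite /= inE andbT eq_sym oppr1_neq1.
apply/eqmxP; rewrite submx1 /= !big_cons big_nil.
have -> : 1%:M = (2%:R^-1 *: (1%:M + A)) + (2%:R^-1 *: (1%:M - A)) :> 'M[F]_n.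
  rewrite -scalerDr addrACA subrr addr0 -mulr2n -scaler_nat scalerA.
  by rewrite mulVf ?scale1r // pnatr_eq0.
apply: addmx_sub_adds; last apply: submx_trans (addsmxSl _ _);
  apply/eigenspaceP.
  by rewrite -scalemxAl mulmxDl mul1mx A2 scale1r addrC.
by rewrite -scalemxAl mulmxBl mul1mx A2 scaleN1r -scalerN opprB.
Qed.

Lemma chr1g (A : el2) (l : chr A) : l 1%g = 1%g.
Proof. exact: hom1 (chr_hom l). Qed.

(** * Real characters, orthogonality and the structure of I_A *)

Section RepresentationTheory.
Variable R : realType.
Implicit Types A B : el2.

Definition chr_sign A (l : chr A) (g : A) : R := (-1) ^+ (l g).

Lemma chr_signM A (l : chr A) : {morph chr_sign l : x y / (x * y)%g >-> x * y}.
Proof.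
by move=> x y; rewrite /chr_sign chrM;
  case: (l x) => -[|[|]] // ?; case: (l y) => -[|[|]] // ?;
  rewrite ?expr0 ?expr1 ?mulr1 ?mul1r ?mulN1r ?opprK.
Qed.

Lemma chr_sign_inj A (l l' : chr A) : chr_sign l =1 chr_sign l' -> l = l'.
Proof.
move=> ll'; apply: chr_eq => x; move: (ll' x); rewrite /chr_sign.
have n1 := oppr1_neq1 R.
by case: (l x) => -[|[|]] // ?; case: (l' x) => -[|[|]] // ?;
  rewrite /= ?expr0 ?expr1 => /eqP; rewrite ?(eq_sym 1) ?(negPf n1) // => _;
  exact: val_inj.
Qed.

Lemma sign_chr A (f : A -> R) : {morph f : x y / (x * y)%g >-> x * y} ->
  (forall x, f x ^+ 2 = 1) -> exists l : chr A, f =1 chr_sign l.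
Proof.
move=> fM f2.
have n1 := oppr1_neq1 R.
have fE x : f x = 1 \/ f x = -1.
  by have /eqP := f2 x; rewrite sqrf_eq1 => /orP[]/eqP ->; [left|right].
pose h (x : A) : C := if f x == 1 then 0 else 1.
have hM : {morph h : x y / (x * y)%g >-> (x * y)%g}.
  move=> x y; rewrite /h fM; case: (fE x) => ->; case: (fE y) => ->;
  by rewrite ?mulr1 ?mul1r ?mulN1r ?opprK ?eqxx ?(negPf n1); apply: val_inj.
exists (hom_chr (mk_hom hM)) => x; rewrite /chr_sign ffunE /= /h.
by case: (fE x) => ->; rewrite ?eqxx ?(negPf n1).
Qed.

(** Translating g by an h on which the two characters differ multiplies the sum by a factor other
    than 1, so it vanishes. *)
Lemma sum_chr_sign A (l l' : chr A) :
  \sum_g chr_sign l g * chr_sign l' g = (#|A| * (l == l'))%:R.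
Proof.
have sq (m : chr A) g : chr_sign m g * chr_sign m g = 1 :> R.
  by rewrite -expr2 sqrr_sign.
case: eqVneq => [<-|nll]; rewrite ?muln1 ?muln0.
  by under eq_bigr do rewrite sq; rewrite sumr_const.
have [h hn] : exists h, chr_sign l h != chr_sign l' h.
  apply: contrapT => nh; case/eqP: nll; apply: chr_sign_inj => x.
  by apply/eqP/negPn/negP => ?; apply: nh; exists x.
set S := \sum_g _.
have : S = (chr_sign l h * chr_sign l' h) * S.
  rewrite {1}/S (reindex_inj (mulgI h)) mulr_sumr; apply: eq_bigr => g _.
  by rewrite !chr_signM mulrACA.
move/eqP; rewrite -subr_eq0 -{1}[S]mul1r -mulrBl mulf_eq0 => /orP[|/eqP //].
rewrite subr_eq0 => /eqP E; case/eqP: hn.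
by rewrite -[LHS]mulr1 -(sq l' h) mulrA -E mul1r.
Qed.

(** The matrices [V g] are commuting involutions, hence simultaneously diagonalizable over the
    reals. Each diagonal entry is multiplicative in g with square 1, that is, a character, and [v]
    counts how often each one occurs. *)
Lemma rep_class_chr A n (V : mx_representation R [set: A] n) :
  exists v : rep A, forall g, \tr (V g) = \sum_l chr_sign l g *+ v l.
Proof.
have Vsq g : V g *m V g = 1%:M.
  by rewrite -repr_mxM ?inE // el2_mulgg repr_mx1.
have Vcomm g h : comm_mx (V g) (V h).
  rewrite /comm_mx -!repr_mxM ?inE //.
  have /abelemP-/(_ isT)[/centsP ab _] := el2_abelem A.
  by rewrite (ab g (in_setT _) h (in_setT _)).
have [P Pu Pd] : codiagonalizable [seq V g | g <- enum A].
  apply/codiagonalizableP; split.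
    by move=> _ _ /mapP[g _ ->] /mapP[h _ ->]; exact: Vcomm.
  by move=> _ /mapP[g _ ->]; apply: involution_diagonalizable.
pose D g := P *m V g *m invmx P.
have Dd g i j : i != j -> D g i j = 0.
  have /allP/(_ (V g)) := Pd; rewrite map_f ?mem_enum // => /(_ isT).
  by move/diagonalizable_forP => /(_ Pu) dg ij; apply: dg.
have DM g h : D (g * h)%g = D g *m D h.
  by rewrite /D repr_mxM ?inE // !mulmxA mulmxKV.
have dM i : {morph (fun g => D g i i) : g h / (g * h)%g >-> g * h}.
  move=> g h; rewrite DM mxE (bigD1 i) //= big1 ?addr0 // => j ji.
  by rewrite Dd ?mul0r // eq_sym.
have d1 g i : D g i i ^+ 2 = 1.
  rewrite expr2 -(dM i g g) el2_mulgg /D repr_mx1 mulmx1 mulmxV //.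
  by rewrite mxE eqxx.
pose li i := sval (cid (sign_chr (dM i) (d1^~ i))).
have liE i g : D g i i = chr_sign (li i) g by rewrite /li; case: cid.
exists [ffun l => #|[set i | li i == l]|] => g.
transitivity (\tr (D g)).
  by rewrite /D mxtrace_mulC mulmxA mulVmx // mul1mx.
rewrite /mxtrace (eq_bigr _ (fun i _ => liE i g)).
rewrite (partition_big li xpredT) //=; apply: eq_bigr => l _.
rewrite ffunE -sumr_const; apply: eq_big => [i|i /eqP <- //].
by rewrite inE.
Qed.

Lemma I_mulrnE A (m : I_ R A) n x : (m *+ n) x = m x *+ n.
Proof.
by elim: n => [|n IH]; rewrite ?mulr0n ?I_zeroE // !mulrS I_addE IH.
Qed.

Lemma I_sumE A (I : finType) (F : I -> I_ R A) x :
  (\sum_i F i) x = \sum_i F i x.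
Proof.
by rewrite (big_morph (fun m : I_ R A => m x) (id1 := 0) (op1 := +%R)) //
  => [m n|]; rewrite ?I_addE ?I_zeroE.
Qed.

Lemma thom_degE A (l : chr A) x : thom_deg R l x = 1 - chr_sign l x.
Proof. by rewrite I_addE int_degE neg_chrE mulr1z. Qed.

Lemma rep_degE A (v : rep A) x :
  rep_deg R v x = \sum_l (1 - chr_sign l x) *+ v l.
Proof.
by rewrite /rep_deg I_sumE; apply: eq_bigr => l _; rewrite I_mulrnE thom_degE.
Qed.

(** Once V is split into characters, k - V becomes (k - dim V) + (dim V - V), the shape of the
    degree of a numerator in [t_inv]. *)
Lemma I_decomp A (m : I_ R A) :
  exists (k : int) (v : rep A), m = int_deg R A k + rep_deg R v.
Proof.
have [k [n [V mE]]] := asboolP _ (I_valP m).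
have [v vE] := rep_class_chr V.
exists (k - Posz (\sum_l v l)%N), v; apply: I_eq => x.
rewrite mE I_addE int_degE rep_degE [LHS]ffunE [X in _ + X]ffunE.
rewrite ffunMzE [X in X *~ _]ffunE [X in - X]ffunE vE.
have -> : \sum_l (1 - chr_sign l x) *+ v l =
    (Posz (\sum_l v l)%N)%:~R - \sum_l chr_sign l x *+ v l.
  rewrite -pmulrn natr_sum -sumrB.
  by apply: eq_bigr => l _; rewrite mulrnBl.
by rewrite intrD intrN addrA subrK.
Qed.

(** The value at 1 is an integer by [dimE]; the floor only recovers it as an element of [int]. *)
Definition dim A (m : I_ R A) : int := Num.floor (m 1%g).

Lemma dim_uniq A (m : I_ R A) (k : int) : m 1%g = k%:~R -> dim m = k.
Proof. by rewrite /dim => ->; rewrite intrKfloor. Qed.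

Lemma rep_deg1 A (v : rep A) : rep_deg R v 1%g = 0.
Proof.
rewrite rep_degE big1 // => l _.
by rewrite /chr_sign chr1g expr0 subrr mul0rn.
Qed.

Lemma dimE A (m : I_ R A) : m 1%g = (dim m)%:~R.
Proof.
have [k [v ->]] := I_decomp m; rewrite I_addE int_degE rep_deg1 addr0.
by rewrite (dim_uniq (k := k)) // I_addE int_degE rep_deg1 addr0.
Qed.

Lemma dim_int A (k : int) : dim (int_deg R A k) = k.
Proof. by apply: dim_uniq; rewrite int_degE. Qed.

Lemma dim_rep A (v : rep A) : dim (rep_deg R v) = 0.
Proof. by apply: dim_uniq; rewrite rep_deg1. Qed.

Lemma dimD A (m n : I_ R A) : dim (m + n) = dim m + dim n.
Proof. by apply: dim_uniq; rewrite I_addE !dimE intrD. Qed.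

Lemma dim_pull B A (f : el2_hom B A) (m : I_ R A) : dim (pull f m) = dim m.
Proof. by apply: dim_uniq; rewrite pullE hom1 dimE. Qed.

Lemma dim0 A : dim (0 : I_ R A) = 0.
Proof. by apply: dim_uniq; rewrite I_zeroE. Qed.

Lemma dim_neg_chr A (l : chr A) : dim (neg_chr R l) = -1.
Proof.
by apply: dim_uniq; rewrite neg_chrE chr1g expr0 mulrN1z.
Qed.

Lemma dim_thom A (l : chr A) : dim (thom_deg R l) = 0.
Proof. by rewrite dimD dim_int dim_neg_chr. Qed.

Lemma rep_decomp A (m : I_ R A) :
  exists v : rep A, m == int_deg R A (dim m) + rep_deg R v.
Proof.
have [k [v mE]] := I_decomp m; exists v; apply/eqP.
by rewrite mE dimD dim_int dim_rep addr0.
Qed.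

(** A genuine choice: the trivial character contributes 0 to [rep_deg], so its multiplicity is
    arbitrary. *)
Definition rep_of A (m : I_ R A) : rep A := xchoose (rep_decomp m).

Lemma rep_ofE A (m : I_ R A) : m = int_deg R A (dim m) + rep_deg R (rep_of m).
Proof. exact/eqP/(xchooseP (rep_decomp m)). Qed.

Definition chr1 A : chr A := hom_chr (comp_hom (from_trivial C) (to_trivial A)).

Lemma chr1E A x : @chr1 A x = 1%g.
Proof. by rewrite ffunE. Qed.

Lemma nontrivialP A (l : chr A) : l != chr1 A -> nontrivial l.
Proof.
move=> nl; apply: contrapT => nh; case/eqP: nl; apply: chr_eq => x.
by rewrite chr1E; apply/eqP/negPn/negP => ?; apply: nh; exists x.
Qed.

(** Pairing dim U - U with a nontrivial character l gives -|A| times the multiplicity of l in U,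
    because the constant dim U is orthogonal to l. *)
Lemma rep_deg_inj A (v w : rep A) : rep_deg R v = rep_deg R w ->
  forall l, l != chr1 A -> v l = w l.
Proof.
move=> vw l nl.
have key u : \sum_g chr_sign l g * rep_deg R u g = - (#|A| * u l)%:R.
  under eq_bigr do rewrite rep_degE mulr_sumr.
  rewrite exchange_big (bigD1 l) //= [X in _ + X]big1 => [|l' nl'].
    under eq_bigr do rewrite -mulr_natr mulrA mulrBr mulr1.
    rewrite -mulr_suml sumrB sum_chr_sign eqxx muln1.
    have := sum_chr_sign l (chr1 A); rewrite (negPf nl) muln0.
    under eq_bigr do rewrite {2}/chr_sign chr1E mulr1.
    by move=> ->; rewrite addr0 sub0r mulNr natrM.
  under eq_bigr do rewrite -mulr_natr mulrA mulrBr mulr1.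
  rewrite -mulr_suml sumrB sum_chr_sign eq_sym (negPf nl') muln0 subr0.
  have := sum_chr_sign l (chr1 A); rewrite (negPf nl) muln0.
  under eq_bigr do rewrite {2}/chr_sign chr1E mulr1.
  by move=> ->; rewrite mul0r.
have := key v; rewrite vw key => /oppr_inj/eqP.
rewrite eqr_nat eqn_pmul2l => [/eqP //|].
by apply/card_gt0P; exists 1%g.
Qed.

End RepresentationTheory.

Ltac deg :=
  rewrite ?rep_degD ?rep_deg0; apply: I_eq => ?;
  rewrite ?(I_addE, int_degE, intrD, I_zeroE); ring.

Section Degrees.
Variable R : realType.
Implicit Types A B : el2.

Lemma rep_deg_chr A (l : chr A) : rep_deg R (rep_chr l) = thom_deg R l.
Proof.
rewrite /rep_deg (bigD1 l) //= big1 => [|l' /negbTE nl].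
  by rewrite ffunE eqxx mulr1n addr0.
by rewrite ffunE nl.
Qed.

(** Reading -l as -1 + (1 - l) lets a_l be the numerator of the degree -1 fraction a_l / t_l. *)
Lemma neg_chr_deg A (l : chr A) :
  neg_chr R l = int_deg R A (- 1) + rep_deg R (rep_chr l).
Proof.
rewrite rep_deg_chr; apply: I_eq => x.
by rewrite !(I_addE, int_degE); ring.
Qed.

Lemma rep_pull_chr B A (f : el2_hom B A) (l : chr A) :
  rep_pull f (rep_chr l) = rep_chr (chr_pull f l).
Proof.
apply/ffunP => mu; rewrite !ffunE.
under eq_bigr do rewrite ffunE.
case: eqVneq => [->|nmu].
  by rewrite (bigD1 l) //= eqxx big1 // => l' /andP[_ /negPf ->].
rewrite big1 // => l' /eqP lmu; case: eqP => // ll'.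
by rewrite -lmu ll' eqxx in nmu.
Qed.

Lemma rep_sum_chr A (v : rep A) : v = \sum_l rep_chr l *+ v l.
Proof.
apply/ffunP => mu; rewrite sum_ffunE (bigD1 mu) //= big1 => [|l nl].
  by rewrite ffunMnE ffunE eqxx addr0 -mulr_natr mul1r natn.
by rewrite ffunMnE ffunE eq_sym (negPf nl) mul0rn.
Qed.

End Degrees.

(** * Elements of a localized algebra, compared in the total space *)

Section Graded.
Variables (R : realType) (X : el2RO_alg R).
Implicit Types A B : el2.

Definition dcast A (m n : I_ R A) (e : m = n) (x : X (RO m)) : X (RO n) :=
  ecast m (X (RO m)) e x.

Lemma hin_dcast A (m n : I_ R A) (e : m = n) x : hin (dcast e x) = hin x.
Proof. by case: _ / e. Qed.

Lemma dcast_linear A (m n : I_ R A) (e : m = n) : linear (dcast e).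
Proof. by case: _ / e. Qed.

HB.instance Definition _ A m n (e : m = n :> I_ R A) :=
  GRing.isLinear.Build _ _ _ _ (dcast e) (dcast_linear e).

Lemma hres_ext B A (f g : el2_hom B A) (x : hel X A) :
  f =1 g -> hres f x = hres g x.
Proof. by move=> /el2_hom_eq ->. Qed.

Lemma hres_id A (x : hel X A) : hres (id_hom A) x = x.
Proof.
case: x => m x; rewrite -[existT _ _ _]/(hin x) -(hres_hin (pull_id m)).
by rewrite res_id.
Qed.

Lemma hin_alg_one : @hin R X trivial_el2 0 (alg_one X) = hone X trivial_el2.
Proof.
rewrite /hone /one hres_hin -[LHS]hres_id.
by apply: hres_ext => x; rewrite [LHS]ord1 [RHS]ord1.
Qed.

(** The diagonal of A x B followed by the product of the two projections is the identity. The
    localization sees only the internal product, so compatibility of the unit with the external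
    pairing is derived from this. *)
Lemma alg_pairE (P Q : el2RO R) (x : X P) (y : X Q) :
  alg_pair x y =
  mul (m := pull (fst_hom P Q) (ro_deg P)) (erefl (ro_deg (RO_prod P Q)))
    (alg_map X (@MkROHom R (RO (pull (fst_hom P Q) (ro_deg P))) P (fst_hom P Q)
      erefl) x)
    (alg_map X (@MkROHom R (RO (pull (snd_hom P Q) (ro_deg Q))) Q (snd_hom P Q)
      erefl) y).
Proof.
rewrite /mul -alg_pair_natural -alg_map_comp -[LHS]alg_map_id.
by apply: alg_map_eq => -[].
Qed.

Lemma hin0_eq A (m n : I_ R A) (x : X (RO m)) :
  hin x = hin (0 : X (RO n)) -> x = 0.
Proof.
move=> E; have mn : m = n := congr1 tag E.
by case: _ / mn E => /hin_inj.
Qed.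

Lemma hmul0 A (n : I_ R A) (h : hel X A) :
  hmul h (hin (0 : X (RO n))) = hin (0 : X (RO (tag h + n))).
Proof. by rewrite /hmul /= linear0. Qed.

End Graded.

Section Localized.
Variables (R : realType) (X : el2RO_alg R) (t : X (RO (thom_deg R sigma))).
Hypothesis t1 : is_inverse_thom t.
Implicit Types A B : el2.

Lemma hin_t_chr A (l : chr A) : hin (t_chr t l) = hres (chr_hom l) (hin t).
Proof. by rewrite /t_chr hres_hin. Qed.

(** The trivial character factors through the trivial group, where t restricts to 1: this is the
    form in which the inverse Thom condition enters. *)
Lemma hin_t_chr1 A : hin (t_chr t (chr1 A)) = hone X A.
Proof.
rewrite hin_t_chr.
rewrite (hres_ext (g := comp_hom (from_trivial C) (to_trivial A))); last first.
  exact: chr1E.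
rewrite hres_comp -(hres_hin (pull_thom_trivial R)) t1 hin_alg_one.
exact: hres_one.
Qed.

(** Together with [rep_deg_inj] this shows that t_V depends only on the degree dim V - V. *)
Lemma ht_eq A (v w : rep A) :
  (forall l, l != chr1 A -> v l = w l) -> ht t v = ht t w.
Proof.
move=> vw; apply: eq_bigr => l _; case: (eqVneq l (chr1 A)) => [->|/vw -> //].
have h1 n : hexp (hone X A) n = hone X A.
  by elim: n => // n IH; rewrite /hexp iterS -/(hexp _ _) IH hmul1x.
by rewrite hin_t_chr1 !h1.
Qed.

Lemma ht_chr A (l : chr A) : ht t (rep_chr l) = hin (t_chr t l).
Proof.
rewrite /ht (bigD1 l) //= big1 => [|l' nl]; last by rewrite ffunE (negPf nl).
by rewrite ffunE eqxx /hexp /= ![hmul _ (hone _ _)]hmulC !hmul1x.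
Qed.

Lemma over_frac A k (v w u : rep A) (x : X (RO (int_deg R A k + rep_deg R v)))
    (y : X (RO (int_deg R A k + rep_deg R w))) :
  hmul (ht t u) (hmul (ht t w) (hin x)) =
  hmul (ht t u) (hmul (ht t v) (hin y)) -> over t x = over t y.
Proof. by move=> E; apply/over_eqP/asboolP; exists u. Qed.

Lemma over_fracE A k (v w : rep A) (x : X (RO (int_deg R A k + rep_deg R v)))
    (y : X (RO (int_deg R A k + rep_deg R w))) :
  over t x = over t y -> exists u,
  hmul (ht t u) (hmul (ht t w) (hin x)) =
  hmul (ht t u) (hmul (ht t v) (hin y)).
Proof. by move=> /over_eqP/asboolP. Qed.

Lemma over_ht A k (v w : rep A) (x : X (RO (int_deg R A k + rep_deg R v)))
    (y : X (RO (int_deg R A k + rep_deg R w))) :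
  ht t v = ht t w -> hin x = hin y -> over t x = over t y.
Proof. by move=> vw xy; apply: (over_frac (u := 0)); rewrite vw xy. Qed.

Lemma over_linear A k (v : rep A) :
  linear (fun x : X (RO (int_deg R A k + rep_deg R v)) => over t x).
Proof.
move=> c x y; rewrite over_scale over_add /frac_add.
apply: (over_frac (u := 0)); rewrite !ht0 !hmul1x.
(* With equal denominators both degree equations are the same statement, so the common factor t_v
   can be taken out of the sum. *)
set e1 := degD_l _ _ _ _; set e2 := degD_r _ _ _ _;
  rewrite (Prop_irrelevance e2 e1).
by rewrite -linearD hin_tmul htD hmulA.
Qed.

Lemma over0 A k (v : rep A) :
  over t (0 : X (RO (int_deg R A k + rep_deg R v))) = 0.
Proof.
have := over_linear (v := v) (k := k) 1 0 0; rewrite !scale1r addr0 => E.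
by apply: (addrI (over t 0)); rewrite addr0; exact: esym E.
Qed.

End Localized.

(** * Total spaces of integer graded algebras *)

Section GradedAlgebra.
Implicit Types G H K : gralg.

Definition gel G := {k : int & G k}.

Definition gin G k (x : G k) : gel G := existT _ k x.

Definition gmul G (x y : gel G) : gel G :=
  gin (gr_mul (erefl (tag x + tag y)) (tagged x) (tagged y)).

Definition gone G : gel G := gin (gr_one G).

Lemma gin_mul G i j k (e : i + j = k) (x : G i) (y : G j) :
  gin (gr_mul e x y) = gmul (gin x) (gin y).
Proof. by case: _ / e. Qed.

Lemma gin_inj G k : injective (@gin G k).
Proof. by move=> x y /eqP; rewrite eq_Tagged => /eqP. Qed.

Lemma gmulA G : associative (@gmul G).
Proof.
case=> [i x] [j y] [k z]; rewrite -!/(gin _).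
rewrite -(gin_mul (erefl (j + k))) -(gin_mul (erefl (i + j))).
rewrite -(gin_mul (addrA i j k)) -(gin_mul (erefl (i + j + k))).
by congr gin; apply: gr_mulA.
Qed.

Lemma gmulC G : commutative (@gmul G).
Proof.
case=> [i x] [j y]; rewrite -!/(gin _).
rewrite -(gin_mul (addrC i j)) -(gin_mul (erefl (j + i))).
by congr gin; apply: gr_mulC.
Qed.

Lemma gmul1x G : left_id (gone G) (@gmul G).
Proof. by case=> [i x]; rewrite -!/(gin _) -(gin_mul (add0r i)) gr_mul1x. Qed.

HB.instance Definition _ G :=
  Monoid.isComLaw.Build (gel G) (gone G) (@gmul G) (@gmulA G) (@gmulC G)
    (@gmul1x G).

Definition gcast G i j (e : i = j) (x : G i) : G j := ecast k (G k) e x.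

Lemma gin_gcast G i j (e : i = j) (x : G i) : gin (gcast e x) = gin x.
Proof. by case: _ / e. Qed.

Lemma gcastKV G i j (e : i = j) : cancel (@gcast G j i (esym e)) (gcast e).
Proof. by case: _ / e. Qed.

Lemma gcast_inj G i j (e : i = j) : injective (@gcast G i j e).
Proof. by case: _ / e. Qed.

Lemma gcast_linear G i j (e : i = j) : linear (@gcast G i j e).
Proof. by case: _ / e. Qed.

HB.instance Definition _ G i j (e : i = j) :=
  GRing.isLinear.Build _ _ _ _ (@gcast G i j e) (@gcast_linear G i j e).

Lemma gr_mul0l G (i j k : int) (e : i + j = k) (y : G j) : gr_mul e 0 y = 0.
Proof.
have := gr_mul_linearl e y 1 0 0; rewrite !scale1r addr0 => E.
by apply: (addrI (gr_mul e 0 y)); rewrite addr0; exact: esym E.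
Qed.

Definition ghom G H (f : gr_hom G H) (x : gel G) : gel H :=
  gin (f _ (tagged x)).

Lemma ghom_gin G H (f : gr_hom G H) k (x : G k) : gin (f k x) = ghom f (gin x).
Proof. by []. Qed.

Lemma ghom_mul G H (f : gr_hom G H) :
  {morph ghom f : x y / gmul x y >-> gmul x y}.
Proof. by move=> [i x] [j y]; rewrite /ghom /gmul /= gh_mul. Qed.

Lemma ghom_one G H (f : gr_hom G H) : ghom f (gone G) = gone H.
Proof. by rewrite -ghom_gin gh_one. Qed.

End GradedAlgebra.

Section El2Algebra.
Variable G : el2_alg.
Implicit Types A B D : el2.

Definition gres B A (f : el2_hom B A) : gel (G A) -> gel (G B) :=
  ghom (ea_map G f).

Lemma gin_res B A (f : el2_hom B A) k (x : G A k) :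
  gin (ea_map G f k x) = gres f (gin x).
Proof. by []. Qed.

Lemma gres_mul B A (f : el2_hom B A) :
  {morph gres f : x y / gmul x y >-> gmul x y}.
Proof. exact: ghom_mul. Qed.

Lemma gres_one B A (f : el2_hom B A) : gres f (gone (G A)) = gone (G B).
Proof. exact: ghom_one. Qed.

Lemma gres_id A (x : gel (G A)) : gres (id_hom A) x = x.
Proof. by case: x => k x; rewrite /gres -/(gin x) -ghom_gin ea_map_id. Qed.

Lemma gres_comp D B A (f : el2_hom B A) (g : el2_hom D B) x :
  gres (comp_hom f g) x = gres g (gres f x).
Proof. by case: x => k x; rewrite /gres -/(gin x) -!ghom_gin ea_map_comp. Qed.

Lemma gres_ext B A (f g : el2_hom B A) x : f =1 g -> gres f x = gres g x.
Proof. by move=> /el2_hom_eq ->. Qed.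

End El2Algebra.

(** * Regrading an el2-algebra by dimension *)

Section RegradedAlgebra.
Variables (R : realType) (G : el2_alg).
Implicit Types P Q S : el2RO R.

Definition dim_obj P : lmodType 'F_2 := G (ro_group P) (dim (ro_deg P)).

(** Homomorphisms preserve 1 and hence evaluation there; this is what makes the regrading
    functorial. *)
Lemma dim_hom P Q (f : RO_hom P Q) : dim (ro_deg Q) = dim (ro_deg P).
Proof. by rewrite -(ro_funP f) dim_pull. Qed.

Definition dim_map P Q (f : RO_hom P Q) (x : dim_obj Q) : dim_obj P :=
  gcast (dim_hom f) (ea_map G f _ x).

Lemma dim_map_linear P Q (f : RO_hom P Q) : linear (dim_map f).
Proof. by move=> c x y; rewrite /dim_map !linearP. Qed.

HB.instance Definition _ P Q (f : RO_hom P Q) :=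
  GRing.isLinear.Build _ _ _ _ (dim_map f) (dim_map_linear f).

Lemma gin_map P Q (f : RO_hom P Q) (x : dim_obj Q) :
  gin (dim_map f x) = gres f (gin x).
Proof. exact: gin_gcast. Qed.

Lemma dim_prod P Q :
  dim (ro_deg P) + dim (ro_deg Q) = dim (ro_deg (RO_prod P Q)).
Proof. by rewrite dimD !dim_pull. Qed.

Definition dim_pair P Q (x : dim_obj P) (y : dim_obj Q) :
    dim_obj (RO_prod P Q) :=
  gr_mul (dim_prod P Q) (ea_map G (fst_hom P Q) _ x)
    (ea_map G (snd_hom P Q) _ y).

Lemma gin_pair P Q (x : dim_obj P) (y : dim_obj Q) :
  gin (dim_pair x y) = gmul (gres (fst_hom P Q) (gin x))
    (gres (snd_hom P Q) (gin y)).
Proof. exact: gin_mul. Qed.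

Definition dim_one : dim_obj (RO_unit R) :=
  gcast (esym (dim0 R trivial_el2)) (gr_one (G trivial_el2)).

Lemma gin_dim_one : gin dim_one = gone (G trivial_el2).
Proof. exact: gin_gcast. Qed.

Lemma dim_map_id P (x : dim_obj P) : dim_map (RO_id P) x = x.
Proof. by apply: gin_inj; rewrite gin_map gres_id. Qed.

Lemma dim_map_comp P Q S (f : RO_hom Q S) (g : RO_hom P Q) (x : dim_obj S) :
  dim_map (RO_comp f g) x = dim_map g (dim_map f x).
Proof. by apply: gin_inj; rewrite !gin_map gres_comp. Qed.

Lemma dim_pair_linearl P Q (y : dim_obj Q) :
  linear (fun x : dim_obj P => dim_pair x y).
Proof. by move=> c x x'; rewrite /dim_pair linearP gr_mul_linearl. Qed.

Lemma dim_pair_linearr P Q (x : dim_obj P) :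
  linear (fun y : dim_obj Q => dim_pair x y).
Proof. by move=> c y y'; rewrite /dim_pair linearP gr_mul_linearr. Qed.

Lemma dim_pair_natural P P' Q Q' (f : RO_hom P P') (g : RO_hom Q Q')
    (x : dim_obj P') (y : dim_obj Q') :
  dim_map (RO_prod_hom f g) (dim_pair x y) =
    dim_pair (dim_map f x) (dim_map g y).
Proof.
apply: gin_inj; rewrite !(gin_map, gin_pair) gres_mul -!gres_comp.
by congr gmul; apply: gres_ext.
Qed.

Lemma dim_pair_assoc P Q S (x : dim_obj P) (y : dim_obj Q) (z : dim_obj S) :
  dim_map (RO_assoc P Q S) (dim_pair x (dim_pair y z)) =
  dim_pair (dim_pair x y) z.
Proof.
apply: gin_inj; rewrite !(gin_map, gin_pair) !gres_mul -!gres_comp -gmulA.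
by congr gmul; [|congr gmul]; apply: gres_ext.
Qed.

Lemma dim_pair_lunit P (x : dim_obj P) :
  dim_map (RO_lunit P) x = dim_pair dim_one x.
Proof.
apply: gin_inj; rewrite !(gin_map, gin_pair) gin_dim_one gres_one gmul1x.
exact: gres_ext.
Qed.

Lemma dim_pair_runit P (x : dim_obj P) :
  dim_map (RO_runit P) x = dim_pair x dim_one.
Proof.
apply: gin_inj; rewrite !(gin_map, gin_pair) gin_dim_one gres_one gmulC gmul1x.
exact: gres_ext.
Qed.

Lemma dim_pair_sym P Q (x : dim_obj P) (y : dim_obj Q) :
  dim_map (RO_swap P Q) (dim_pair y x) = dim_pair x y.
Proof.
apply: gin_inj; rewrite !(gin_map, gin_pair) gres_mul -!gres_comp gmulC.
by congr gmul; apply: gres_ext.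
Qed.

Definition dim_alg : el2RO_alg R :=
  @MkEl2ROAlg R dim_obj
    (fun P Q f => dim_map f : {linear dim_obj Q -> dim_obj P})
    dim_map_id dim_map_comp dim_pair dim_one dim_pair_linearl dim_pair_linearr
    dim_pair_natural dim_pair_assoc dim_pair_lunit dim_pair_runit dim_pair_sym.

Implicit Types A B : el2.

(* Unlike hin, hgin is injective only on each X(A, m): it forgets m except for
   its dimension, so that all t_V become equal to 1. *)
Definition hgin A (x : hel dim_alg A) : gel (G A) :=
  @gin (G A) (dim (tag x)) (tagged x).

Lemma hgin_res B A (f : el2_hom B A) m n (e : pull f m = n)
    (x : dim_alg (RO m)) :
  @gin (G B) _ (res dim_alg e x) = gres f (@gin (G A) (dim m) x).
Proof. exact: (gin_map (@MkROHom R (RO n) (RO m) f e)). Qed.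

(** Both projections become the identity along the diagonal, so the internal product is that of
    G. *)
Lemma gin_dim_mul A m n k (e : m + n = k :> I_ R A) (x : dim_alg (RO m))
    (y : dim_alg (RO n)) :
  @gin (G A) (dim k) (mul e x y) = gmul (@gin (G A) (dim m) x)
    (@gin (G A) (dim n) y).
Proof.
rewrite /mul [LHS](gin_map (RO_diag e)) gin_pair gres_mul -!gres_comp.
rewrite -[in RHS](gres_id (@gin (G A) (dim m) x))
  -[in RHS](gres_id (@gin (G A) (dim n) y)).
by congr gmul; apply: gres_ext.
Qed.

Definition dim_t : dim_alg (RO (thom_deg R sigma)) :=
  gcast (esym (dim_thom R sigma)) (gr_one (G C)).

Lemma gin_dim_t : @gin (G C) _ dim_t = gone (G C).
Proof. exact: gin_gcast. Qed.

Lemma dim_t_thom : is_inverse_thom dim_t.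
Proof.
apply: gin_inj.
by rewrite (hgin_res (pull_thom_trivial R) dim_t) gin_dim_t gres_one
  -gin_dim_one.
Qed.

Definition dim_a (e : G C (-1)) : dim_alg (RO (neg_chr R sigma)) :=
  gcast (esym (dim_neg_chr R sigma)) e.

Lemma gin_dim_a e : @gin (G C) _ (dim_a e) = gin e.
Proof. exact: gin_gcast. Qed.

End RegradedAlgebra.

(** * The right adjoint on objects and morphisms *)

Section RightAdjoint.
Variable (R : realType).

Lemma gin_a_chr (G : group_law) A (l : chr A) :
  @gin (G A) _ (a_chr (dim_a R (gl_e G)) l) = gin (e_chr (gl_e G) l).
Proof. by rewrite [LHS](hgin_res (pull_sigma R l)) gin_dim_a. Qed.

(** Adding -l lowers the dimension by one, so the sequence at m is the coordinate sequence of G in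
    degree dim m - 1, transported along [e1], [e2] and [e3]. *)
Lemma dim_orientable (G : group_law) : is_orientable (dim_a R (gl_e G)).
Proof.
move=> A m l nl; have [inj ex surj] := @gl_coordinate G A l (dim m - 1) nl.
set k := dim m - 1 in inj ex surj.
have e1 : dim m = 1 + k by rewrite /k addrC subrK.
have e2 : dim (m + neg_chr R l) = k by rewrite dimD dim_neg_chr.
have e3 : k = dim (pull (ker_incl l) m + int_deg R (ker_chr l) (- 1)).
  by rewrite dimD dim_pull dim_int.
have mulE (x : dim_alg R G (RO m)) :
  gcast e2 (mul (addrC (neg_chr R l) m) (a_chr (dim_a R (gl_e G)) l) x) =
  gr_mul (addKr 1 k) (e_chr (gl_e G) l) (gcast e1 x).
  apply: gin_inj; rewrite gin_mul [X in gmul _ X]gin_gcast [LHS]gin_gcast.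
  by rewrite [LHS]gin_dim_mul gin_a_chr.
have resE (y : dim_alg R G (RO (m + neg_chr R l))) :
  res _ (pull_ker m l) y = gcast e3 (ea_map G (ker_incl l) k (gcast e2 y)).
  apply: gin_inj; rewrite [LHS](hgin_res (pull_ker m l)) [RHS]gin_gcast gin_res.
  by rewrite [in RHS]gin_gcast.
split.
- move=> x y /(congr1 (gcast e2)); rewrite !mulE => /inj.
  exact: gcast_inj.
- move=> y; rewrite resE; split.
    rewrite -[X in _ = X -> _](linear0 (gcast e3)) => /gcast_inj/ex[x xE].
    exists (gcast (esym e1) x); apply: (@gcast_inj _ _ _ e2).
    by rewrite mulE gcastKV.
  case=> x <-; rewrite mulE (proj2 (ex _)) ?linear0 //.
  by exists (gcast e1 x).
move=> z; have [y yE] := surj (gcast (esym e3) z).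
by exists (gcast (esym e2) y); rewrite resE gcastKV yE gcastKV.
Qed.

Definition dim_oriented (G : group_law) : oriented R :=
  Oriented (@dim_orientable G) (dim_t_thom R G).

Lemma gin_t_chr (G : el2_alg) A (l : chr A) :
  @gin (G A) _ (t_chr (dim_t R G) l) = gone (G A).
Proof. by rewrite [LHS](hgin_res (pull_thom_sigma R l)) gin_dim_t gres_one. Qed.

(** Multiplication by t_l is multiplication by 1, up to a transport between degrees of equal
    dimension. *)
Lemma dim_invertible (G : group_law) : invertibly_oriented (dim_oriented G).
Proof.
move=> A l m nl.
have e : dim (m + thom_deg R l) = dim m by rewrite dimD dim_thom addr0.
apply: (@eq_bij _ _ (gcast (esym e))).
  exists (gcast e) => x; first exact: gcastKV.
  by rewrite -{2}(esymK e) gcastKV.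
move=> x; apply: gin_inj; rewrite [RHS]gin_dim_mul [LHS]gin_gcast gin_t_chr.
by rewrite gmul1x.
Qed.

Section Map.
Variables (G H : group_law) (f : group_law_hom G H).

Definition dim_fun (P : el2RO R) : {linear dim_alg R G P -> dim_alg R H P} :=
  f (ro_group P) (dim (ro_deg P)).

Lemma ghom_gres A B (g : el2_hom B A) (x : gel (G A)) :
  ghom (f B) (gres g x) = gres g (ghom (f A) x).
Proof. by rewrite /gres /ghom /= glh_natural. Qed.

Lemma gin_dim_fun P (x : dim_alg R G P) :
  @gin (H _) _ (dim_fun P x) = ghom (f _) (@gin (G _) (dim (ro_deg P)) x).
Proof. by []. Qed.

Lemma dim_fun_natural (P Q : el2RO R) (g : RO_hom P Q) (x : dim_alg R G Q) :
  dim_fun P (alg_map _ g x) = alg_map _ g (dim_fun Q x).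
Proof. by apply: gin_inj; rewrite gin_dim_fun !gin_map ghom_gres. Qed.

Lemma dim_fun_pair (P Q : el2RO R) (x : dim_alg R G P) (y : dim_alg R G Q) :
  dim_fun _ (alg_pair x y) = alg_pair (dim_fun P x) (dim_fun Q y).
Proof.
by apply: gin_inj; rewrite gin_dim_fun !gin_pair ghom_mul !ghom_gres.
Qed.

Lemma dim_fun_one :
  dim_fun (RO_unit R) (alg_one (dim_alg R G)) = alg_one (dim_alg R H).
Proof. by apply: gin_inj; rewrite gin_dim_fun !gin_dim_one ghom_one. Qed.

Definition dim_alg_hom : alg_hom (dim_alg R G) (dim_alg R H) :=
  MkAlgHom dim_fun_natural dim_fun_pair dim_fun_one.

Lemma dim_fun_a : dim_fun _ (dim_a R (gl_e G)) = dim_a R (gl_e H).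
Proof. by apply: gin_inj; rewrite gin_dim_fun !gin_dim_a -ghom_gin glh_e. Qed.

Lemma dim_fun_t : dim_fun _ (dim_t R G) = dim_t R H.
Proof. by apply: gin_inj; rewrite gin_dim_fun !gin_dim_t ghom_one. Qed.

Definition dim_oriented_hom : oriented_hom (dim_oriented G) (dim_oriented H) :=
  @MkOrientedHom R (dim_oriented G) (dim_oriented H) dim_alg_hom dim_fun_a
    dim_fun_t.

End Map.

Definition dim_functor : functor group_law_cat (oriented_cat R).
Proof.
refine (@Functor group_law_cat (oriented_cat R) dim_oriented dim_oriented_hom
  _ _).
- by move=> G; apply: oriented_hom_eq.
- by move=> G H K f g; apply: oriented_hom_eq.
Defined.

End RightAdjoint.

(** * Retraction onto the kernel, and the coordinate a / t *)

Section Retraction.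
Variables (A : el2) (l : chr A) (x0 : A).
Hypothesis lx0 : l x0 != 1%g.

(** The kernel has index two, and multiplication by x0 carries its other coset into it. *)
Let r (g : A) : A := if l g == 1%g then g else (g * x0)%g.

Lemma C_mul_neq1 (x y : C) : x != 1%g -> y != 1%g -> (x * y)%g = 1%g.
Proof.
by case: x => -[|[|]] // ?; case: y => -[|[|]] // ? _ _; apply: val_inj.
Qed.

Lemma retractP g : r g \in ('ker (chr_hom l))%g.
Proof.
apply/kerP; rewrite ?inE // /r; case: eqVneq => //= lg.
by rewrite chrM C_mul_neq1.
Qed.

(** The decisive case has x and y both outside the kernel: their product lies inside, and the two
    factors x0 cancel. *)
Lemma retractM : {morph (fun g => subg ('ker (chr_hom l))%g (r g)) :
  x y / (x * y)%g >-> (x * y)%g}.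
Proof.
move=> x y; apply: val_inj; rewrite /= !subgK ?retractP //.
have /abelemP-/(_ isT)[/centsP ab _] := el2_abelem A.
have abC u w : (u * w = w * u)%g := ab u (in_setT _) w (in_setT _).
rewrite /r chrM; case: (eqVneq (l x)) => [->|lx]; rewrite ?mul1g.
  by case: ifP => _; rewrite ?mulgA.
case: (eqVneq (l y)) => [->|ly]; rewrite ?mulg1 ?(negPf lx).
  by rewrite -!mulgA [(x0 * y)%g]abC.
by rewrite C_mul_neq1 // eqxx (abC y) mulgA -[(x * x0 * x0)%g]mulgA el2_mulgg
  mulg1.
Qed.

Definition retract : el2_hom A (ker_chr l) :=
  mk_hom (B := A) (A := ker_chr l) retractM.

Lemma retract_incl : comp_hom retract (ker_incl l) =1 id_hom (ker_chr l).
Proof.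
move=> x; apply: val_inj; rewrite /= subgK ?retractP // /r.
by have := ker_inclP x; rewrite /= => ->; rewrite eqxx.
Qed.

End Retraction.

Section Coordinate.
Variables (R : realType) (X : oriented R).
Implicit Types A B : el2.
Let t := or_t X.
Let a := or_a X.

Lemma hin_a_chr A (l : chr A) : hin (a_chr a l) = hres (chr_hom l) (hin a).
Proof. by rewrite /a_chr hres_hin. Qed.

Lemma a_chr_inj A (l : chr A) (m : I_ R A) (x y : X (RO m)) :
  nontrivial l ->
  hmul (hin (a_chr a l)) (hin x) = hmul (hin (a_chr a l)) (hin y) ->
  x = y.
Proof.
move=> nl; have [inj _ _] := or_orientable X m nl.
rewrite -!(hin_mul (addrC (neg_chr R l) m)) => /hin_inj; exact: inj.
Qed.

Lemma e_chr_over A (l : chr A) :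
  e_chr (t_inv_e X) l = over t (dcast (neg_chr_deg R l) (a_chr a l)).
Proof.
rewrite /e_chr [LHS]loc_resE /frac_res; apply: over_hin.
  rewrite rep_pull_chr; congr rep_chr; apply: chr_eq => x.
  by rewrite chr_pullE ffunE.
by rewrite hres_hin hin_dcast hin_a_chr; case: _ / over_a_deg.
Qed.

Lemma over_eq0 A k (v : rep A) (x : X (RO (int_deg R A k + rep_deg R v))) :
  over t x = 0 -> exists u, tmul t (erefl (rep_deg R u + _)) x = 0.
Proof.
move=> /over_fracE[u]; rewrite ht0 hmul1x !hmul0 -(hin_tmul _ (erefl _)).
by move=> E; exists u; apply: hin0_eq E.
Qed.

Lemma rep_pull_retract A (l : chr A) x0 (lx0 : l x0 != 1%g)
    (w : rep (ker_chr l)) :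
  rep_pull (ker_incl l) (rep_pull (retract lx0) w) = w.
Proof.
by rewrite -rep_pull_comp (el2_hom_eq (retract_incl lx0)) rep_pull_id.
Qed.

(** As a_l times 1, the class a_l lies in the image of multiplication by a_l in the exact sequence
    for m = 0. *)
Lemma res_a_chr A (l : chr A) n (e : pull (ker_incl l) (neg_chr R l) = n) :
  nontrivial l -> res X e (a_chr a l) = 0.
Proof.
move=> nl; have [_ ex _] := or_orientable X 0 nl.
have /ex : exists x : X (RO 0), mul (addrC (neg_chr R l) 0) (a_chr a l) x =
    mul (addrC (neg_chr R l) 0) (a_chr a l) (one X A) by exists (one X A).
move=> /(congr1 (@hin R X _ _)); rewrite hres_hin
  (hin_mul (addrC (neg_chr R l) 0)).
rewrite -[hin (one X A)]/(hone X A) hmulC hmul1x => E; apply: hin0_eq;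
  rewrite hres_hin; exact: E.
Qed.

Lemma ker_chr_trivial A (l : chr A) :
  chr_pull (ker_incl l) l = chr1 (ker_chr l).
Proof. by apply: chr_eq => x; rewrite chr_pullE ker_inclP chr1E. Qed.

Lemma thom_coordinate : is_coordinate (t_inv_e X).
Proof.
have t1 := or_thom X.
move=> A l k nl; have [x0 lx0] := nl.
have eE v (x : X (RO (int_deg R A (1 + k) + rep_deg R v))) :
  gr_mul (addKr 1 k) (e_chr (t_inv_e X) l) (over t x) =
  over t (mul (degD_mul R (addKr 1 k) (rep_chr l) v)
     (dcast (neg_chr_deg R l) (a_chr a l)) x).
  by rewrite e_chr_over; exact: loc_mulE.
have resE v (x : X (RO (int_deg R A k + rep_deg R v))) :
  ea_map (t_inv X) (ker_incl l) k (over t x) =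
    over t (res X (res_deg R (ker_incl l) k v) x).
  exact: loc_resE.
split.
(* Injectivity: both products have t_l in the denominator, so after cancelling a_l inside X the
   fractions agree with multiplier u + l. *)
- elim/overW=> v x; elim/overW=> w y; rewrite !eE => /over_fracE[u].
  rewrite !hin_mul hin_dcast !htD.
  set d := int_deg R A (1 + k) + rep_deg R (u + rep_chr l + v + w).
  have ex : rep_deg R (u + rep_chr l + w) +
      (int_deg R A (1 + k) + rep_deg R v) = d.
    by rewrite /d; deg.
  have ey : rep_deg R (u + rep_chr l + v) +
      (int_deg R A (1 + k) + rep_deg R w) = d.
    by rewrite /d; deg.
  move=> E; have /(a_chr_inj nl) : hmul (hin (a_chr a l)) (hin (tmul t ex x)) =
      hmul (hin (a_chr a l)) (hin (tmul t ey y)).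
    rewrite !hin_tmul !htD.
    transitivity (hmul (ht t u) (hmul (hmul (ht t (rep_chr l)) (ht t w))
      (hmul (hin (a_chr a l)) (hin x)))).
      by rewrite (@hmul R X A).[AC (1*(3*1)) (2*(3*4)*(1*5))] !hmulA.
    by rewrite E (@hmul R X A).[AC (1*(2*2)) (4*(1*2*3)*5)] !hmulA.
  move=> /(congr1 (@hin R X _ _)); rewrite !hin_tmul => {}E.
  by apply: (over_frac (u := u + rep_chr l)); rewrite !hmulA -!htD.
- elim/overW=> v x; rewrite resE; split; last first.
    case=> q E; rewrite -resE -E gh_mul.
    have -> : ea_map (t_inv X) (ker_incl l) (-1) (e_chr (t_inv_e X) l) = 0.
      rewrite e_chr_over [LHS]loc_resE /frac_res.
      rewrite (_ : res _ _ _ = 0) ?over0 //.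
      apply: hin0_eq; rewrite hres_hin hin_dcast -(hres_hin (erefl _)).
      by rewrite res_a_chr.
    exact: gr_mul0l.
  (* A fraction vanishes on K only after multiplication by some t_u'. Pulled back along the
     retraction, u' becomes a representation of A whose restriction is u' again. *)
  move=> /over_eq0[u' E]; pose u := rep_pull (retract lx0) u'.
  (* The degree of t_u x need not have the form m - l with m in I_A. Multiplying by t_l adds 1 - l:
     the 1 moves the integer part to 1 + k, and -l is the summand that exactness needs. *)
  pose m := int_deg R A (1 + k) + rep_deg R (v + u).
  have em : rep_deg R (u + rep_chr l) + (int_deg R A k + rep_deg R v) =
      m + neg_chr R l.
    by rewrite /m !rep_degD rep_deg_chr /thom_deg; deg.
  have [_ ex _] := or_orientable X m nl.
  have /ex[y yE] : res X (pull_ker m l) (tmul t em x) = 0.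
    apply: hin0_eq.
    rewrite hres_hin hin_tmul hres_mul hres_ht rep_pullD rep_pull_retract htD.
    rewrite -(hres_hin (res_deg R (ker_incl l) k v)) [hmul (ht _ u') _]hmulC
      -hmulA.
    rewrite -(hin_tmul _ (erefl _)) E.
    exact: hmul0.
  exists (over t y); rewrite eE; apply: (over_frac (u := 0)).
  rewrite hin_mul hin_dcast -(hin_mul (addrC (neg_chr R l) m)) yE hin_tmul !ht0
    !hmul1x hmulA -htD.
  by congr (hmul (ht t _) _); rewrite [rep_chr l + _]addrC addrA.
elim/overW=> w z; pose v := rep_pull (retract lx0) w.
(* The integer part is 1 + k because the exact sequence subtracts 1 on K. The lift has degree m - l
   = k + (dim V - V) + (1 - l), so it is divided by t_v t_l, and t_l restricts to 1 on K. *)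
pose m := int_deg R A (1 + k) + rep_deg R v.
have em : int_deg R (ker_chr l) k + rep_deg R w =
    pull (ker_incl l) m + int_deg R (ker_chr l) (- 1).
  by rewrite /m pullD pull_int pull_sum rep_pull_retract; deg.
have [_ _ /(_ (dcast em z))[y yE]] := or_orientable X m nl.
have ey : m + neg_chr R l = int_deg R A k + rep_deg R (v + rep_chr l).
  by rewrite /m rep_degD rep_deg_chr /thom_deg; deg.
exists (over t (dcast ey y)); rewrite resE; apply: over_ht.
  by rewrite rep_pullD rep_pull_retract rep_pull_chr htD ht_chr ker_chr_trivial
    hin_t_chr1 // hmulC hmul1x.
rewrite hres_hin hin_dcast -(hres_hin (pull_ker m l)) yE.
exact: hin_dcast.
Qed.

End Coordinate.

Lemma inj_surj_bij (T U : Type) (f : T -> U) :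
  injective f -> (forall y, exists x, f x = y) -> bijective f.
Proof.
move=> inj surj; exists (fun y => sval (cid (surj y))) => x.
  by case: cid => y /= /inj.
by case: cid.
Qed.

(** * The unit of the adjunction *)

Section Unit.
Variables (R : realType) (X : oriented R).
Implicit Types A B : el2.
Let t := or_t X.
Let t1 : is_inverse_thom t := or_thom X.

Definition over_thom A (m : I_ R A) (x : X (RO m)) : t_inv X A (dim m) :=
  over t (dcast (rep_ofE m) x).

Lemma over_thom_linear A (m : I_ R A) : linear (@over_thom A m).
Proof. by move=> c x y; rewrite /over_thom linearP over_linear. Qed.

HB.instance Definition _ A (m : I_ R A) :=
  GRing.isLinear.Build _ _ _ _ (@over_thom A m) (@over_thom_linear A m).

(** Any denominator that fits the degree may replace the chosen one, since the two differ only in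
    trivial summands. Compatibility of the unit with products, restrictions, 1, a and t reduces to
    this. *)
Lemma over_thomE A k (m : I_ R A) (v : rep A) (x : X (RO m))
    (y : X (RO (int_deg R A k + rep_deg R v))) :
  hin x = hin y -> gin (over_thom x) = @gin (t_inv X A) k (over t y).
Proof.
move=> xy; have mE : m = int_deg R A k + rep_deg R v := congr1 tag xy.
have kE : dim m = k by rewrite mE dimD dim_int dim_rep addr0.
case: k / kE mE y xy => mE y xy; congr gin; apply: over_ht => //.
  apply: (ht_eq t1) => l; apply: (@rep_deg_inj R).
  have := rep_ofE m; rewrite {1}mE => E; apply: I_eq => x0.
  have := congr1 (fun m : I_ R A => m x0) E; rewrite !I_addE.
  by move=> /addrI.
by rewrite hin_dcast.
Qed.

Lemma gin_over_mul A i j (v w : rep A)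
    (x : X (RO (int_deg R A i + rep_deg R v)))
    (y : X (RO (int_deg R A j + rep_deg R w))) :
  gmul (@gin (t_inv X A) i (over t x)) (@gin (t_inv X A) j (over t y)) =
  @gin (t_inv X A) (i + j) (over t (mul (degD_mul R erefl v w) x y)).
Proof. by rewrite -[LHS](gin_mul erefl) [gr_mul _ _ _]loc_mulE. Qed.

Lemma gin_over_res B A (f : el2_hom B A) k (v : rep A)
    (x : X (RO (int_deg R A k + rep_deg R v))) :
  gres f (@gin (t_inv X A) k (over t x)) =
  @gin (t_inv X B) k (over t (res X (res_deg R f k v) x)).
Proof. by rewrite -gin_res [ea_map _ _ _ _]loc_resE. Qed.

Lemma gin_loc_one A : gone (t_inv X A) = @gin (t_inv X A) 0 (loc_one t A).
Proof. by []. Qed.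

Lemma over_thom_mul A m n k (e : m + n = k :> I_ R A) x y :
  gin (over_thom (mul e x y)) = gmul (gin (over_thom x)) (gin (over_thom y)).
Proof.
by rewrite gin_over_mul; apply: over_thomE; rewrite !hin_mul !hin_dcast.
Qed.

Lemma over_thom_res B A (f : el2_hom B A) m n (e : pull f m = n :> I_ R B) x :
  gin (over_thom (res X e x)) = gres f (gin (over_thom x)).
Proof.
by rewrite gin_over_res; apply: over_thomE; rewrite !hres_hin !hin_dcast.
Qed.

Definition eta_fun (P : el2RO R) : {linear X P -> dim_alg R (t_inv X) P} :=
  match P with RO A m => @over_thom A m end.

Lemma eta_natural (P Q : el2RO R) (f : RO_hom P Q) (x : X Q) :
  eta_fun P (alg_map X f x) = alg_map _ f (eta_fun Q x).
Proof.
case: P Q f x => [B n] [A m] [f e] x; apply: gin_inj.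
rewrite [RHS]gin_map /=; exact: over_thom_res e x.
Qed.

Lemma eta_pair (P Q : el2RO R) (x : X P) (y : X Q) :
  eta_fun _ (alg_pair x y) = alg_pair (eta_fun P x) (eta_fun Q y).
Proof.
case: P Q x y => [A m] [B n] x y; apply: gin_inj.
rewrite [RHS]gin_pair alg_pairE [LHS]over_thom_mul.
by congr gmul; apply: over_thom_res.
Qed.

Lemma eta_one : eta_fun (RO_unit R) (alg_one X) = alg_one (dim_alg R (t_inv X)).
Proof.
apply: gin_inj; rewrite [RHS]gin_dim_one gin_loc_one; apply: over_thomE.
by rewrite hin_one hin_alg_one.
Qed.

Definition eta_alg_hom : alg_hom X (dim_alg R (t_inv X)) :=
  MkAlgHom eta_natural eta_pair eta_one.

Lemma eta_a : eta_fun _ (or_a X) = dim_a R (t_inv_e X).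
Proof.
apply: gin_inj; rewrite [RHS]gin_dim_a; apply: over_thomE.
by case: _ / over_a_deg.
Qed.

Lemma thom_sigma_deg :
  thom_deg R sigma = int_deg R C 0 + rep_deg R (rep_chr sigma).
Proof. by rewrite rep_deg_chr; deg. Qed.

Lemma eta_t : eta_fun _ (or_t X) = dim_t R (t_inv X).
Proof.
apply: gin_inj; rewrite [RHS]gin_dim_t gin_loc_one.
rewrite [LHS](over_thomE (esym (hin_dcast thom_sigma_deg _))).
(* This is t / t_sigma = 1: sigma is the identity character, so t_sigma is t itself. *)
congr gin; apply: (over_frac (u := 0)).
rewrite hin_dcast hin_one !ht0 !hmul1x hmulC hmul1x ht_chr hin_t_chr.
by rewrite -[LHS]hres_id; apply: hres_ext => x; rewrite /= ffunE.
Qed.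

(** The hypothesis concerns single nontrivial characters. It extends to all t_V by composition,
    since for the trivial character multiplication is only a transport. Then common factors cancel,
    which gives injectivity, and y / t_W is hit by the solution x of t_W x = t_V y. *)
Lemma eta_bij : invertibly_oriented X -> forall P, bijective (eta_fun P).
Proof.
move=> Xinv.
have tmul_dcast A (v : rep A) (m n : I_ R A) (e : rep_deg R v + m = n) :
  ht t v = hone X A -> bijective (tmul t e).
  move=> v1; have mn : m = n.
    by rewrite -e -(tag_ht t) v1 add0r.
  exists (dcast (esym mn)) => x; apply: hin_inj;
  by rewrite ?hin_dcast hin_tmul ?hin_dcast v1 hmul1x.
have tmul_bij A (v : rep A) : forall (m n : I_ R A) (e : rep_deg R v + m = n),
  bijective (tmul t e).
  have TD (u w : rep A) :
    (forall m n (e : rep_deg R u + m = n), bijective (tmul t e)) ->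
    (forall m n (e : rep_deg R w + m = n), bijective (tmul t e)) ->
    forall m n (e : rep_deg R (u + w) + m = n), bijective (tmul t e).
    move=> Tu Tw m n e.
    have e' : rep_deg R u + (rep_deg R w + m) = n by rewrite addrA -rep_degD.
    apply: (@eq_bij _ _ (tmul t e' \o tmul t erefl)); first exact: bij_comp.
    by move=> x; apply: tmul_tmul.
  have T0 m n (e : rep_deg R (0 : rep A) + m = n) : bijective (tmul t e).
    by apply: tmul_dcast; rewrite ht0.
  rewrite (rep_sum_chr v); elim/big_ind: _ => // l _.
  elim: (v l) => [|d IH]; first by rewrite mulr0n.
  rewrite mulrS; apply: TD => // m n e; case: (eqVneq l (chr1 A)) =>
    [l1|/nontrivialP nl].
    by apply: tmul_dcast; rewrite l1 ht_chr hin_t_chr1.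
  have [g gK Kg] := Xinv A l m nl.
  have e' : n = m + thom_deg R l by rewrite -e rep_deg_chr addrC.
  have E x : dcast e' (tmul t e x) = mul (addrC (thom_deg R l) m) (t_chr t l) x.
    by apply: hin_inj; rewrite hin_dcast hin_tmul hin_mul ht_chr.
  apply: inj_surj_bij => [x y /(congr1 (dcast e'))|y].
    by rewrite !E => /(can_inj gK).
  exists (g (dcast e' y)); apply: hin_inj.
  by rewrite -(hin_dcast e') E Kg hin_dcast.
case=> A m; apply: inj_surj_bij => [x y /over_fracE[u]|p].
  rewrite !hmulA -htD -!(hin_tmul _ erefl) !hin_tmul !hin_dcast
    -!(hin_tmul _ erefl).
  by move=> /hin_inj; apply: (bij_inj (tmul_bij _ _ _ _ _)).
elim/overW: p => w y; set v := rep_of m.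
have e : rep_deg R w + m = rep_deg R v + (int_deg R A (dim m) + rep_deg R w).
  have mE : m = int_deg R A (dim m) + rep_deg R v := rep_ofE m.
  by rewrite [in LHS]mE; deg.
have [g gK Kg] := tmul_bij _ _ _ _ e.
exists (g (tmul t erefl y)); apply: (over_frac (u := 0)).
by rewrite hin_dcast -(hin_tmul t e) Kg hin_tmul.
Qed.

End Unit.

(** * Pointwise bijective morphisms are isomorphisms *)

Section Inverses.
Variable R : realType.

Lemma oriented_iso (X Y : oriented_cat R) (f : cat_hom X Y) :
  (forall P, bijective (oh_fun f P)) -> isomorphic X Y.
Proof.
move=> fbij.
have inv P : {g : Y P -> X P | cancel (oh_fun f P) g & cancel g (oh_fun f P)}.
  by apply: cid2; case: (fbij P) => g; exists g.
pose g P := s2val (inv P).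
have fK P : cancel (oh_fun f P) (g P) := s2valP (inv P).
have gK P : cancel (g P) (oh_fun f P) := s2valP' (inv P).
have glin P : linear (g P) := can2_linear (fK P) (gK P).
pose gl P : {linear Y P -> X P} :=
  HB.pack (g P) (GRing.isLinear.Build _ _ _ _ (g P) (glin P)).
have gnat (P Q : el2RO R) (h : RO_hom P Q) (y : Y Q) :
    gl P (alg_map Y h y) = alg_map X h (gl Q y).
  by apply: (can_inj (fK P)); rewrite ah_natural /= !gK.
have gpair (P Q : el2RO R) (x : Y P) (y : Y Q) :
    gl _ (alg_pair x y) = alg_pair (gl P x) (gl Q y).
  by apply: (can_inj (fK _)); rewrite ah_pair /= !gK.
have gone1 : gl _ (alg_one Y) = alg_one X.
  by apply: (can_inj (fK _)); rewrite ah_one /= !gK.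
have ga : MkAlgHom gnat gpair gone1 _ (or_a Y) = or_a X.
  by apply: (can_inj (fK _)); rewrite oh_a /= !gK.
have gt : MkAlgHom gnat gpair gone1 _ (or_t Y) = or_t X.
  by apply: (can_inj (fK _)); rewrite oh_t /= !gK.
exists f, (MkOrientedHom ga gt); split; apply: oriented_hom_eq => P x /=.
  exact: gK.
exact: fK.
Qed.

Lemma group_law_inverse (G H : group_law_cat) (f : cat_hom G H) :
  (forall A k, bijective (glh_fun f A k)) ->
  exists g : cat_hom H G, cat_comp f g = cat_id H /\ cat_comp g f = cat_id G.
Proof.
move=> fbij.
have inv A k : {g : H A k -> G A k |
    cancel (glh_fun f A k) g & cancel g (glh_fun f A k)}.
  by apply: cid2; case: (fbij A k) => g; exists g.
pose g A k := s2val (inv A k).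
have fK A k : cancel (glh_fun f A k) (g A k) := s2valP (inv A k).
have gK A k : cancel (g A k) (glh_fun f A k) := s2valP' (inv A k).
have glin A k : linear (g A k) := can2_linear (fK A k) (gK A k).
pose gl A k : {linear H A k -> G A k} :=
  HB.pack (g A k) (GRing.isLinear.Build _ _ _ _ (g A k) (glin A k)).
have gm A (i j k : int) (e : i + j = k) x y :
    gl A k (gr_mul e x y) = gr_mul e (gl A i x) (gl A j y).
  by apply: (can_inj (fK A k)); rewrite gh_mul /= !gK.
have g1 A : gl A 0 (gr_one (H A)) = gr_one (G A).
  by apply: (can_inj (fK _ _)); rewrite gh_one /= !gK.
have gn B A (h : el2_hom B A) k x : MkGrHom (gm B) (g1 B) k (ea_map H h k x) =
    ea_map G h k (MkGrHom (gm A) (g1 A) k x).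
  by apply: (can_inj (fK _ _)); rewrite glh_natural /= !gK.
have ge : MkGrHom (gm C) (g1 C) (-1) (gl_e H) = gl_e G.
  by apply: (can_inj (fK _ _)); rewrite glh_e /= !gK.
exists (@MkGroupLawHom H G (fun A => MkGrHom (gm A) (g1 A)) gn ge).
split; apply: group_law_hom_eq => A k x /=; [exact: gK | exact: fK].
Qed.

End Inverses.

(** * The counit and its invertibility *)

Section Counit.
Variables (R : realType) (H : group_law).
Implicit Types A B : el2.
Let X := dim_oriented R H.
Let t := or_t X.

Lemma hgin_mul A (x y : hel X A) : hgin (hmul x y) = gmul (hgin x) (hgin y).
Proof. by case: x y => [m x] [n y]; exact: gin_dim_mul. Qed.

Lemma hgin_one A : hgin (hone X A) = gone (H A).
Proof.
rewrite [LHS](hgin_res (pull0 R (to_trivial A)) (alg_one X)) gin_dim_one.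
exact: gres_one.
Qed.

(** All denominators become 1 once a degree is remembered only through its dimension; hence the
    localization adds nothing. *)
Lemma hgin_ht A (v : rep A) : hgin (ht t v) = gone (H A).
Proof.
rewrite /ht (big_morph (@hgin R H A) (@hgin_mul A) (@hgin_one A)).
apply: big1 => l _; elim: (v l) => [|n IH]; first exact: hgin_one.
by rewrite /hexp iterS -/(hexp _ _) hgin_mul IH gmulC gmul1x [LHS]gin_t_chr.
Qed.

Lemma dim_frac A k (v : rep A) : dim (int_deg R A k + rep_deg R v) = k.
Proof. by rewrite dimD dim_int dim_rep addr0. Qed.

(** The counit drops the denominator: a numerator of degree k + dim V - V has dimension k and is
    already an element of H(A) in degree k. *)
Definition eps_fun A k (p : loc t A k) : H A k :=
  gcast (dim_frac k (tag (repr p))) (tagged (repr p)).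

Lemma eps_over A k (v : rep A) (x : X (RO (int_deg R A k + rep_deg R v))) :
  eps_fun (over t x) = gcast (dim_frac k v) x.
Proof.
rewrite /eps_fun; have := over_repr (over t x).
move: (tag (repr (over t x))) (tagged (repr (over t x))) => w y.
move=> /over_fracE[u] /(congr1 (@hgin R H A));
  rewrite !hgin_mul !hgin_ht !gmul1x => E.
by apply: gin_inj; rewrite !gin_gcast.
Qed.

Lemma gin_eps A k (v : rep A) (x : X (RO (int_deg R A k + rep_deg R v))) :
  gin (eps_fun (over t x)) = hgin (hin x).
Proof. by rewrite eps_over gin_gcast. Qed.

Lemma eps_tmul A k (v w : rep A) m
    (e : rep_deg R v + m = int_deg R A k + rep_deg R w)
    (e' : dim m = k) (x : X (RO m)) :
  gcast (dim_frac k w) (tmul t e x) = gcast e' x.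
Proof.
apply: gin_inj; rewrite [LHS]gin_gcast [RHS]gin_gcast.
rewrite -[LHS]/(hgin (hin (tmul t e x))).
by rewrite hin_tmul hgin_mul hgin_ht gmul1x.
Qed.

Lemma eps_linear A k : linear (@eps_fun A k).
Proof.
move=> c; elim/overW=> v x; elim/overW=> w y.
rewrite over_scale over_add /frac_add !eps_over linearD /=.
by rewrite !(eps_tmul _ (dim_frac _ _)) linearZ.
Qed.

HB.instance Definition _ A k :=
  GRing.isLinear.Build _ _ _ _ (@eps_fun A k) (@eps_linear A k).

Lemma eps_mul A (i j k : int) (e : i + j = k) (p : loc t A i) (q : loc t A j) :
  eps_fun (loc_mul e p q) = gr_mul e (eps_fun p) (eps_fun q).
Proof.
elim/overW: p => v x; elim/overW: q => w y; rewrite loc_mulE.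
by apply: gin_inj; rewrite gin_mul !gin_eps hin_mul hgin_mul.
Qed.

Lemma eps_one A : eps_fun (loc_one t A) = gr_one (H A).
Proof. by apply: gin_inj; rewrite gin_eps hin_one hgin_one. Qed.

Definition eps_gr A : gr_hom (t_inv X A) (H A) :=
  @MkGrHom (t_inv X A) (H A)
    (fun k => @eps_fun A k : {linear t_inv X A k -> H A k})
    (@eps_mul A) (@eps_one A).

Lemma eps_natural B A (f : el2_hom B A) k (p : t_inv X A k) :
  eps_gr B k (ea_map (t_inv X) f k p) = ea_map H f k (eps_gr A k p).
Proof.
elim/overW: p => v x; rewrite /= loc_resE; apply: gin_inj.
rewrite gin_eps gin_res gin_eps; exact: hgin_res.
Qed.

Lemma eps_e : eps_gr C (-1) (t_inv_e X) = gl_e H.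
Proof.
apply: gin_inj; rewrite /= gin_eps -[RHS](gin_dim_a R).
by case: _ / over_a_deg.
Qed.

Lemma eps_bij A k : bijective (eps_gr A k).
Proof.
have e : k = dim (int_deg R A k + rep_deg R 0) by rewrite dim_frac.
(* The inverse regards y as a fraction over the zero representation. It agrees with y / t_V because
   t_V acts as the identity on underlying elements of H. *)
exists (fun y => over t (v := 0)
  (gcast e y : X (RO (int_deg R A k + rep_deg R 0)))).
  elim/overW=> v x; rewrite /= eps_over.
  have d : rep_deg R v + (int_deg R A k + rep_deg R 0) =
      int_deg R A k + rep_deg R v.
    by deg.
  apply: (over_frac (u := 0)); rewrite ht0 !hmul1x -(hin_tmul _ d); congr hin.
  apply: (@gin_inj (H A)); rewrite -[LHS]/(hgin (hin (tmul t d _))) hin_tmul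
    hgin_mul.
  by rewrite hgin_ht gmul1x [LHS]gin_gcast gin_gcast.
move=> y; apply: gin_inj; rewrite /= gin_eps; exact: gin_gcast.
Qed.

End Counit.

(** * The adjunction, full faithfulness and the essential image *)

Section Adjunction.
Variable R : realType.
Variable coord : forall X : oriented R, is_coordinate (t_inv_e X).
Let F := t_inv_functor coord.
Let G := dim_functor R.

Definition eta (X : oriented_cat R) : cat_hom X (G (F X)) :=
  @MkOrientedHom R X (dim_oriented R (F X)) (eta_alg_hom X) (eta_a X) (eta_t X).

Definition eps (H : group_law_cat) : cat_hom (F (G H)) H :=
  @MkGroupLawHom (F (G H)) H (eps_gr R H) (@eps_natural R H) (eps_e R H).

Definition transpose (X : oriented_cat R) (H : group_law_cat)
    (f : cat_hom (F X) H) :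
  cat_hom X (G H) := cat_comp (fmap G f) (eta X).

(** The triangle identities are checked on elements. If g is the transpose of f, then F g sends x /
    t_V to g(x) / t_V, and the counit leaves g(x), which is f(x / t_V) by the formula for the
    unit. *)
Lemma transpose_bij X H : bijective (@transpose X H).
Proof.
exists (fun g => cat_comp (eps H) (fmap F g)) => f.
  apply: group_law_hom_eq => A k; elim/overW=> v x /=.
  rewrite (loc_mapE (oh_t (transpose f)) x); apply: gin_inj.
  rewrite [LHS]gin_eps -[LHS]/(ghom (f A) (gin (over_thom x))).
  by rewrite (over_thomE (erefl (hin x))).
apply: oriented_hom_eq => -[A m] x; apply: (@gin_inj (H A)).
rewrite /= /over_thom (loc_mapE (oh_t f)) gin_eps.
by case: _ / (rep_ofE m).
Qed.

(** The right adjoint on morphisms is thus precomposition with the counit followed by transposition.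
    Both are bijective, which gives full faithfulness. *)
Lemma transpose_counit (H K : group_law_cat) (f : cat_hom H K) :
  transpose (cat_comp f (eps H)) = fmap G f.
Proof.
apply: oriented_hom_eq => -[A m] x; apply: (@gin_inj (K A)).
rewrite /= /over_thom -[LHS]/(ghom (f A) (gin (eps_fun _))) gin_eps.
by case: _ / (rep_ofE m).
Qed.

Lemma t_inv_dim_adjoint : right_adjoint F G.
Proof.
exists transpose; split; first exact: transpose_bij.
- move=> X Y H f g; apply: oriented_hom_eq => -[A m] x /=.
  rewrite /over_thom (loc_mapE (oh_t f)); congr (glh_fun g A _ _).
  by apply: over_hin => //; rewrite hin_dcast; case: _ / (rep_ofE m).
- by move=> X H K f g; apply: oriented_hom_eq.
Qed.

Lemma dim_fully_faithful : fully_faithful G.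
Proof.
move=> H K; have [e [eK Ke]] := group_law_inverse (f := eps H) (@eps_bij R H).
apply: (@eq_bij _ _ (@transpose (G H) K \o fun f => cat_comp f (eps H))).
  apply: bij_comp (transpose_bij _ _) _.
  by exists (fun f => cat_comp f e) => f; rewrite -cat_compA ?eK ?Ke cat_compm1.
by move=> f; apply: transpose_counit.
Qed.

(** An isomorphism preserves t and so conjugates multiplication by t_l on X into the bijective one
    on a regraded algebra. Conversely, [eta] is an isomorphism onto the image of F X. *)
Lemma dim_essential_image (X : oriented_cat R) :
  essential_image G X <-> invertibly_oriented X.
Proof.
split=> [[H [f [g [fg gf]]]]|Xinv]; last first.
  have [f [g [fg gf]]] := oriented_iso (f := eta X) (eta_bij Xinv).
  by exists (F X), g, f.
have fgE P x : oh_fun f P (oh_fun g P x) = x.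
  exact: (congr1 (fun h : oriented_hom X X => h P x) fg).
have gfE P x : oh_fun g P (oh_fun f P x) = x.
  exact: (congr1 (fun h : oriented_hom (G H) (G H) => h P x) gf).
move=> A l m nl; apply: (@eq_bij _ _ (oh_fun f _ \o
  (mul (addrC (thom_deg R l) m) (t_chr (or_t (G H)) l) \o oh_fun g _))).
  apply: bij_comp; last apply: bij_comp.
  - by exists (oh_fun g _) => x; rewrite ?gfE ?fgE.
  - exact: (@dim_invertible R H).
  - by exists (oh_fun f _) => x; rewrite ?gfE ?fgE.
move=> x; rewrite /= ah_mul fgE /t_chr ah_res.
have <- : oh_fun f _ (dim_t R H) = or_t X := oh_t f.
by [].
Qed.

End Adjunction.

(** Part (i) is the leading existential, because the functor of part (ii) takes the coordinate
    property as an argument. *)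
Theorem theorem8p2 (R : realType) :
  exists coord : forall X : oriented R, is_coordinate (t_inv_e X),
  exists G : functor group_law_cat (oriented_cat R),
    [/\ right_adjoint (t_inv_functor coord) G,
        fully_faithful G
      & forall X : oriented_cat R,
          essential_image G X <-> invertibly_oriented X].
Proof.
exists (@thom_coordinate R), (dim_functor R); split.
- exact: t_inv_dim_adjoint.
- exact: dim_fully_faithful (@thom_coordinate R).
- exact: dim_essential_image (@thom_coordinate R).
Qed.
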